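(* Let $F(Z) = \sum_{N \geq 0} a(N) \, \exp(2 \pi i \, \textup{Tr}(NZ)) \in M_k^2(\Gamma)$ be an eigenform. \begin{enumerate} \item If $a(I)=0$, then $a(mI)=0$ for all $m \in \mathbb{Z}^{+}$. \item $a(I) \, a(mnI) = a(mI) \, a(nI)$ when $\gcd(m,n)=1$. \item For all primes $p$ and all $r \geq 1$, \begin{multline*} a(I)\, a(p^{r+1} I) = a(pI)\, a(p^{r} I) - p^{2k-3} \, a(I)\, a(p^{r-1} I) \\ - p^{k-2} \, a(I) \Biggl[ 2 \, a\left(\left(\begin{smallmatrix} p^{r-1} & 0 \\ 0 & p^{r+1} \end{smallmatrix}\right)\right) + (1+ (-1)^k) \sum^{\frac{p-1}{2}}_{\substack{u = 1 \\ u^2 \not\equiv -1 \pmod{p}}} a\left( p^r \left(\begin{smallmatrix} (1+u^2)p^{-1} & u \\ u & p \end{smallmatrix} \right) \right) \Biggr], \end{multline*} where the last sum is vacuous in the case $p=2$. \end{enumerate}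
   Context: $M_k^2(\Gamma)$ denotes the space of Siegel modular forms of degree 2 and weight $k$ on the full modular group $\Gamma=\mathrm{Sp}_4(\mathbb{Z})$. Every $F\in M_k^2(\Gamma)$ has a Fourier expansion $F(Z)=\sum_{N} a(N)\exp(2\pi i\,\textup{Tr}(NZ))$ over symmetric positive semi-definite rational $2\times 2$ matrices $N=(N_{ij})$ with $N_{ii}, 2N_{ij}\in\mathbb{Z}$. $I$ is the $2\times 2$ identity matrix. $F$ is an eigenform if it is an eigenfunction of all Hecke operators on $M_k^2(\Gamma)$. *)

(* Defs.v *)
(* MathComp-Analysis *)
From HB Require Import structures.
From mathcomp Require Import all_boot all_order all_algebra.
From mathcomp Require Import all_classical all_reals all_analysis.
From mathcomp.analysis.showcase Require Import summability.
From mathcomp Require Import complex.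

Set Implicit Arguments.
Unset Strict Implicit.
Unset Printing Implicit Defensive.

Import Order.TTheory GRing.Theory Num.Theory.
Import numFieldNormedType.Exports.

Local Open Scope classical_set_scope.
Local Open Scope complex_scope.
Local Open Scope ring_scope.

Definition mx22 (K : Type) (a b c d : K) : 'M[K]_2 :=
  \matrix_(i < 2, j < 2)
    if i == 0 then (if j == 0 then a else b) else (if j == 0 then c else d).

Definition posdef_mx (K : realFieldType) (n : nat) (Y : 'M[K]_n) : Prop :=
  Y^T = Y /\ forall v : 'rV[K]_n, v != 0 -> 0 < (v *m Y *m v^T) 0 0.

Definition possemidef_mx (K : realFieldType) (n : nat) (Y : 'M[K]_n) : Prop :=
  Y^T = Y /\ forall v : 'rV[K]_n, 0 <= (v *m Y *m v^T) 0 0.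

Definition cexp (R : realType) (z : R[i]) : R[i] :=
  (expR (complex.Re z))%:C * (cos (complex.Im z) +i* sin (complex.Im z)).

Definition siegel_upper_half (R : realType) : set 'M[R[i]]_2 :=
  [set Z | Z^T = Z /\ posdef_mx (map_mx (@complex.Im R) Z)].

(* (w_0, w_1, w_2) |-> [[w_0, w_1], [w_1, w_2]], the coordinates on the
   3-dimensional space of symmetric matrices. *)
Definition sym_mx (R : realType) (w : 'rV[R[i]]_3) : 'M[R[i]]_2 :=
  \matrix_(i < 2, j < 2) w 0 (inord (i + j)).

(* Functions on the upper half space are represented by functions on all
   matrices, whose values outside of siegel_upper_half are irrelevant.
   Differentiability is over the complex field. *)
Definition holomorphic_on_siegel (R : realType) (F : 'M[R[i]]_2 -> R[i]) :
    Prop :=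
  forall w : 'rV[R[i]]_3, siegel_upper_half (sym_mx w) ->
    differentiable ((fun x => F (sym_mx x)) : 'rV[R[i]]_3 -> R[i]^o)
      (w : ('rV[R[i]]_3 : normedModType R[i])).

Definition symplectic_J : 'M[int]_(2 + 2) := block_mx 0 1%:M (- 1%:M) 0.

(* Integral symplectic similitudes of multiplier mu. *)
Definition similitude (mu : nat) : set 'M[int]_(2 + 2) :=
  [set M | M^T *m symplectic_J *m M = mu%:R *: symplectic_J].

Definition Sp4Z : set 'M[int]_(2 + 2) := similitude 1.

Section Action.
Variable R : realType.
Implicit Types (M : 'M[int]_(2 + 2)) (Z : 'M[R[i]]_2).

Let toC (A : 'M[int]_2) : 'M[R[i]]_2 := map_mx intr A.

(* For M = [[A, B], [C, D]]: C Z + D, then (A Z + B) (C Z + D)^-1. *)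
Definition siegel_denom M Z : 'M[R[i]]_2 :=
  toC (dlsubmx M) *m Z + toC (drsubmx M).

Definition siegel_act M Z : 'M[R[i]]_2 :=
  (toC (ulsubmx M) *m Z + toC (ursubmx M)) *m invmx (siegel_denom M Z).

Definition slash (k : int) M (F : 'M[R[i]]_2 -> R[i]) Z : R[i] :=
  \det (siegel_denom M Z) ^ (- k) * F (siegel_act M Z).

End Action.

(* The space M_k^2(Sp_4(Z)). In degree 2 no growth condition is imposed: by the
   Koecher principle it is automatic. *)
Definition siegel_modular_form (R : realType) (k : int)
    (F : 'M[R[i]]_2 -> R[i]) : Prop :=
  holomorphic_on_siegel F /\
  forall M Z, Sp4Z M -> siegel_upper_half Z ->
    F (siegel_act M Z) = \det (siegel_denom M Z) ^ k * F Z.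

Definition half_integral_psd (R : realType) : set 'M[rat]_2 :=
  [set N | [/\ possemidef_mx (map_mx ratr N : 'M[R]_2),
               forall i, N i i \is a Num.int
             & forall i j, 2 * N i j \is a Num.int]].

Definition fourier_term (R : realType) (a : 'M[rat]_2 -> R[i])
    (Z : 'M[R[i]]_2) (N : 'M[rat]_2) : R[i] :=
  if N \in half_integral_psd R
  then a N * cexp (2 * (@pi R)%:C * 'i%C * \tr (map_mx ratr N *m Z)) else 0.

(* The sum is unconditional (equivalently, absolutely convergent): it is the
   limit of the partial sums along the directed set of finite index sets. *)
Definition fourier_expansion (R : realType) (F : 'M[R[i]]_2 -> R[i])
    (a : 'M[rat]_2 -> R[i]) : Prop :=
  forall Z, siegel_upper_half Z ->
    (partial_sum (fourier_term a Z : 'M[rat]_2 -> R[i]^o) @ totally)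
      --> (F Z : R[i]^o).

Definition double_coset (g : 'M[int]_(2 + 2)) : set 'M[int]_(2 + 2) :=
  [set h | exists x y, [/\ Sp4Z x, Sp4Z y & h = x *m g *m y]].

(* Sp_4(Z) \ Sp_4(Z) g Sp_4(Z), as a set of subsets of the double coset. *)
Definition right_cosets (g : 'M[int]_(2 + 2)) : set (set 'M[int]_(2 + 2)) :=
  [set [set x *m h | x in Sp4Z] | h in double_coset g].

(* The Hecke operator of the double coset of a similitude g of multiplier mu,
     F |-> mu^(2k-3) sum_(h in Sp_4(Z) \ Sp_4(Z) g Sp_4(Z)) F |_k h.
   Each coset, of which there are finitely many, is represented by a chosen
   element; on modular forms of weight k the choice is immaterial. *)
Definition hecke_op (R : realType) (k : int) (mu : nat) (g : 'M[int]_(2 + 2))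
    (F : 'M[R[i]]_2 -> R[i]) (Z : 'M[R[i]]_2) : R[i] :=
  mu%:R ^ (2 * k - 3) *
  \sum_(C \in right_cosets g) slash k (xget (0 : 'M[int]_(2 + 2)) C) F Z.

(* The operators of the double cosets span the Hecke algebra, so that their
   common eigenfunctions are those of all Hecke operators. *)
Definition hecke_eigenform (R : realType) (k : int)
    (F : 'M[R[i]]_2 -> R[i]) : Prop :=
  [/\ siegel_modular_form k F,
      exists2 Z, siegel_upper_half Z & F Z != 0
    & forall (mu : nat) (g : 'M[int]_(2 + 2)), (0 < mu)%N -> similitude mu g ->
      exists lambda : R[i], forall Z, siegel_upper_half Z ->
        hecke_op k mu g F Z = lambda * F Z].

(* Main.v *)
Require Import Defs.
From HB Require Import structures.
From mathcomp Require Import all_boot all_order all_algebra.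
From mathcomp Require Import all_classical all_reals all_analysis.
From mathcomp.analysis.showcase Require Import summability.
From mathcomp Require Import complex finmap.
From mathcomp Require Import ring lra zify.

Set Implicit Arguments.
Unset Strict Implicit.
Unset Printing Implicit Defensive.

Import Order.TTheory GRing.Theory Num.Theory.
Import numFieldNormedType.Exports.
Local Open Scope classical_set_scope.
Local Open Scope complex_scope.
Local Open Scope ring_scope.

(* Expanding F along the block triangular representatives of the cosets of
   multiplier n, with diagonal blocks (n D^-T, D) and D in Hermite normal form,
   the coefficient at m I of the image of F under the sum of all Hecke operators
   of multiplier n, for m prime to n, is a combination of those a(T) for which
   T = (m / n) D D^T is half-integral and the sum over the upper right blocks
   does not vanish. This forces D = (a, a u; 0, n) with n/a | 1 + u^2, so that T
   is m a times an integral form of determinant 1. By reduction theory such a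
   form is SL_2(Z)-equivalent to I. Hence lambda(n) a(m I) is a combination,
   with coefficients independent of m, of the a(m d I) with d | n, and induction
   on n gives a(m n I) = l(n) a(m I). For n = p and the matrices p^r I all the
   terms can be written down; eliminating the eigenvalue gives the recursion. *)

(** The eigenform condition concerns functions, the theorem the coefficients of a given expansion;
    identities pass from one to the other by uniqueness of unconditional expansions. It is proved
    without integration: averaging over rational translates kills finitely many unwanted
    coefficients, and what remains is a small tail. Eigenvalues are added over all double cosets of
    multiplier n because the cosets of multiplier n, taken together, are listed exactly by reduced
    triangular matrices, while no list for a single double coset is at hand. For fixed D the upper
    right blocks form a finite group on which the exponentials are a character, so their sum is zero
    or the order of the group. For m prime to n, nonvanishing forces divisibilities from which m
    cancels; for m = p^r the character is trivial and no term drops out. Nothing is divided by a(I):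
    l(n) comes from the nonzero weight of D = n I, and in the recursion the equation at p^r I is
    multiplied by a(I). The roots of u^2 = -1 mod p contribute alike to the equations at I and at
    p^r I, hence cancel. *)

Section Exponential.
Variable R : realType.
Local Notation C := R[i].

(** * The character exp(2 pi i q) of the rational numbers *)

Lemma cexpD (x y : C) : cexp (x + y) = cexp x * cexp y.
Proof.
case: x y => [a b] [c d]; rewrite /cexp /= expRD cosD sinD; simpc.
by congr (_ +i* _); ring.
Qed.

Lemma cexp0 : cexp (0 : C) = 1.
Proof. by rewrite /cexp /= expR0 cos0 sin0; simpc. Qed.

Lemma cexp_neq0 (x : C) : cexp x != 0.
Proof.
apply/eqP => x0; have /eqP := cexpD x (- x).
by rewrite x0 mul0r subrr cexp0 oner_eq0.
Qed.

Definition uexp (q : rat) : C := cexp (2 * (@pi R)%:C * 'i%C * ratr q).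

Lemma uexpE q : uexp q = cos (2 * pi * ratr q) +i* sin (2 * pi * ratr q).
Proof.
rewrite /uexp.
have -> : ratr q = (ratr q)%:C :> C by rewrite [RHS](fmorph_rat (real_complex R)).
have -> : 2 * (@pi R)%:C * 'i%C * (ratr q)%:C = 0 +i* (2 * pi * ratr q).
  by rewrite -[2]/(2%:R) -(rmorph_nat (real_complex R)); simpc.
by rewrite /cexp /= expR0; simpc.
Qed.

Lemma uexpD q r : uexp (q + r) = uexp q * uexp r.
Proof. by rewrite /uexp (rmorphD (ratr : rat -> C)) [X in cexp X]mulrDr cexpD. Qed.

Lemma uexp0 : uexp 0 = 1.
Proof. by rewrite /uexp rmorph0 mulr0 cexp0. Qed.

Lemma uexpN q : uexp (- q) = (uexp q)^-1.
Proof.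
apply: (mulIf (cexp_neq0 (2 * (@pi R)%:C * 'i%C * ratr q))).
by rewrite -/(uexp q) -uexpD addNr uexp0 mulVf// cexp_neq0.
Qed.

Lemma uexp_half : uexp 2^-1 = -1.
Proof.
rewrite uexpE fmorphV rmorph_nat.
rewrite mulrAC divff ?pnatr_eq0// mul1r cospi sinpi.
by apply/eqP; rewrite eq_complex /= oppr0 !eqxx.
Qed.

Lemma uexp_int q : q \is a Num.int -> uexp q = 1.
Proof.
move=> /intrP[m ->].
have u1 : uexp 1 = 1.
  rewrite (_ : 1 = 2^-1 + 2^-1); last by field.
  by rewrite uexpD uexp_half mulrNN mulr1.
have un (n : nat) : uexp n%:R = 1.
  by elim: n => [|n IH]; [rewrite uexp0 | rewrite -natr1 uexpD u1 IH mulr1].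
case: m => n; first exact: un.
by rewrite NegzE rmorphN uexpN [uexp _](un n.+1) invr1.
Qed.

(** A fractional part r in (0, 1) would satisfy cos(2 pi r) = 1, so cos^2 - sin^2 = cos^2 + sin^2 at
    pi r, although sin(pi r) > 0. *)
Lemma uexp_eq1 q : uexp q = 1 -> q \is a Num.int.
Proof.
move=> h; set r := q - (Num.floor q)%:~R.
have r01 : 0 <= r < 1.
  have /andP[] := real_floor_itv (num_real q).
  by rewrite /r rmorphD /= => h1 h2; apply/andP; split; lra.
have ur : uexp r = 1 by rewrite /r uexpD uexpN h uexp_int ?intr_int// invr1 mulr1.
have [r0|r0] := eqVneq r 0.
  by move/eqP: r0; rewrite subr_eq0 => /eqP ->; exact: intr_int.
exfalso; move: ur; rewrite uexpE => /eqP; rewrite eq_complex /= => /andP[/eqP + _].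
rewrite -mulrA -[2 * _]/(2%:R * _) mulr_natl cosD -!expr2.
have := cos2Dsin2 (pi * ratr r : R).
have s0 : 0 < sin (pi * ratr r : R).
  have rr : 0 < (ratr r : R) < 1.
    rewrite ltr0q -[X in _ && (_ < X)](rmorph1 (ratr : rat -> R)) ltr_rat.
    by move: r01 => /andP[a1 ->]; rewrite lt_neqAle eq_sym r0 a1.
  apply: sin_gt0_pi; rewrite mulr_gt0 ?pi_gt0//=; last by case/andP: rr.
  by rewrite gtr_pMr ?pi_gt0//; case/andP: rr.
have s2 : 0 < sin (pi * ratr r : R) ^+ 2 by rewrite exprn_gt0.
clear h; move: s2; set s := sin _ ^+ 2; set c := cos _ ^+ 2 => s2 e1 e2.
have : s + s = 0 by rewrite -(subrr (1 : R)) -{1}e1 -e2; ring.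
by move/eqP; rewrite gt_eqF ?addr_gt0.
Qed.

Lemma norm_uexp q : `|uexp q| = 1.
Proof. by rewrite uexpE normc_def /= cos2Dsin2 sqrtr1. Qed.

End Exponential.

(** * Unconditional sums *)

#[local] Existing Instance totally_filter.

Section UnconditionalSums.
Variables (R : realType) (I : choiceType).
Local Notation C := R[i].

(** Convergence along finite subsets. In the order of [R[i]], [0 < eps] already makes [eps] a
    positive real. *)
Definition sums_to (x : I -> C) (l : C) : Prop :=
  forall eps : C, 0 < eps -> exists A : {fset I},
    forall B, (A `<=` B)%fset -> `|l - \sum_(i <- B) x i| < eps.

Lemma cvg_sums_to (x : I -> C) (l : C) :
  (partial_sum (x : I -> C^o) @ totally) --> (l : C^o) -> sums_to x l.
Proof.
move=> h e e0.
have [A _ hA] : \forall B \near totally, `|l - partial_sum (x : I -> C^o) B| < e.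
  exact: (proj1 (cvgrPdist_lt _ _) h).
exists A => B AB; rewrite (big_seq_fsetE _ B predT).
exact: (hA B AB).
Qed.

Lemma sums_toZ (x : I -> C) l c : sums_to x l -> sums_to (fun i => c * x i) (c * l).
Proof.
move=> h e e0.
have c0 : 0 < `|c| + 1 by rewrite ltr_wpDl.
have [A hA] := h (e / (`|c| + 1)) (divr_gt0 e0 c0); exists A => B /hA.
rewrite -mulr_sumr -mulrBr normrM ltr_pdivlMr// => hB.
apply: le_lt_trans hB; rewrite mulrC ler_wpM2l// lerDl//.
Qed.

Lemma sums_toD (x y : I -> C) l m :
  sums_to x l -> sums_to y m -> sums_to (fun i => x i + y i) (l + m).
Proof.
move=> hx hy e e0; have e2 : 0 < e / 2 by rewrite divr_gt0.
have [A hA] := hx _ e2; have [A' hA'] := hy _ e2.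
exists (A `|` A')%fset => B; rewrite fsubUset => /andP[/hA h1 /hA' h2].
rewrite big_split/= (splitr e) opprD addrACA.
by apply: le_lt_trans (ler_normD _ _) _; apply: ltrD.
Qed.

Lemma sums_to0 : sums_to (fun=> 0) 0.
Proof.
move=> e e0; exists fset0 => B _.
by rewrite big1// subrr normr0.
Qed.

Lemma sums_to_sum (J : Type) (s : seq J) (P : pred J) (x : J -> I -> C) (l : J -> C) :
  (forall j, P j -> sums_to (x j) (l j)) ->
  sums_to (fun i => \sum_(j <- s | P j) x j i) (\sum_(j <- s | P j) l j).
Proof.
move=> h; elim: s => [|j s IH].
  rewrite big_nil (_ : (fun i => _) = fun=> 0); first exact: sums_to0.
  by apply: funext => i; rewrite big_nil.
rewrite big_cons; case: ifP => Pj; last first.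
  by rewrite (_ : (fun i => _) = fun i => \sum_(j <- s | P j) x j i)//;
    apply: funext => i; rewrite big_cons Pj.
rewrite (_ : (fun i => _) = fun i => x j i + \sum_(j <- s | P j) x j i).
  by apply: sums_toD => //; exact: h.
by apply: funext => i; rewrite big_cons Pj.
Qed.

Lemma sums_to_reindex (x : I -> C) l (phi psi : I -> I) :
  cancel phi psi -> cancel psi phi -> sums_to x l -> sums_to (x \o phi) l.
Proof.
move=> phiK psiK h e e0.
have [A hA] := h e e0; exists [fset psi i | i in A]%fset => B AB.
have -> : \sum_(i <- B) (x \o phi) i = \sum_(i <- [fset phi i | i in B]%fset) x i.
  by rewrite big_imfset//= => i j _ _; exact: (can_inj phiK).
apply: hA; apply/fsubsetP => i iA; apply/imfsetP; exists (psi i) => //=.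
by apply: (fsubsetP AB); apply/imfsetP; exists i.
Qed.

(* Splitting a sum according to the signs of the real and imaginary parts,
   unconditional convergence bounds the sums of the absolute values. *)
Lemma sums_to_norm_tail (x : I -> C) l : sums_to x l ->
  forall eps : C, 0 < eps -> exists A : {fset I},
    forall K, [disjoint A & K]%fset -> \sum_(i <- K) `|x i| < eps.
Proof.
move=> h e e0.
(* A finite sum disjoint from A is a difference of two remainders, hence below e/4; the two signs of
   the real part cost e/2, and so do those of the imaginary part. *)
have e8 : 0 < e / 8 by rewrite divr_gt0.
have [A hA] := h _ e8; exists A => K AK.
have small L : [disjoint A & L]%fset -> `|\sum_(i <- L) x i| < e / 4.
  move=> AL; have := hA _ (fsubsetUl A L); have := hA _ (fsubset_refl A).
  have -> : \sum_(i <- (A `|` L)%fset) x i = \sum_(i <- A) x i + \sum_(i <- L) x i.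
    rewrite (big_fsetID _ (mem A))/=; congr (_ + _); apply: eq_fbigl => i.
      rewrite !inE /= andbC.
      by apply: andb_idr => iA; rewrite iA.
    rewrite !inE /=; apply/andP/idP => [[/orP[->|//]]//|iL].
    by rewrite iL orbT; split=> //; apply: contraL iL => /(fdisjointP AL).
  set u := \sum_(i <- L) x i; set s := \sum_(i <- A) x i => h1 h2.
  rewrite (_ : u = (l - s) - (l - (s + u))); last by ring.
  apply: le_lt_trans (ler_normB _ _) _.
  rewrite (_ : e / 4 = e / 8 + e / 8); last by field.
  by apply: ltrD.
have part (f : {additive C -> R}) : (forall z, `|f z|%:C <= `|z|) ->
    (\sum_(i <- K) `|f (x i)|)%:C < e / 2.
  move=> fle.
  pose P := [fset i in K | 0 <= f (x i)]%fset.
  pose M := [fset i in K | ~~ (0 <= f (x i))]%fset.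
  have PK : [disjoint A & P]%fset.
    by apply: fdisjointWr AK; apply/fsubsetP => i; rewrite !inE => /andP[].
  have MK : [disjoint A & M]%fset.
    by apply: fdisjointWr AK; apply/fsubsetP => i; rewrite !inE => /andP[].
  have -> : \sum_(i <- K) `|f (x i)| = f (\sum_(i <- P) x i) - f (\sum_(i <- M) x i).
    rewrite !raddf_sum /= (bigID (fun i => 0 <= f (x i)))/=; congr (_ + _).
      rewrite -big_fset_condE/=; apply: eq_bigr => i h0; exact: ger0_norm.
    rewrite -big_fset_condE/=; apply: eq_bigr => i h0; apply: ler0_norm.
    by rewrite -ltNge in h0; exact: ltW.
  rewrite rmorphB /=.
  have b z : (f z)%:C <= `|z|.
    by apply: le_trans (fle z); rewrite lecR ler_norm.
  have b' z : - (f z)%:C <= `|z|.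
    by rewrite -(rmorphN (real_complex R)); apply: le_trans (fle z);
      rewrite lecR -normrN ler_norm.
  rewrite (_ : e / 2 = e / 4 + e / 4); last by field.
  apply: ltrD.
    by apply: le_lt_trans (b _) _; exact: small.
  by apply: le_lt_trans (b' _) _; exact: small.
have p1 := part (@complex.Re R : {additive Rcomplex R -> R}) _.
have p2 := part (@complex.Im R : {additive Rcomplex R -> R}) _.
rewrite (splitr e); apply: (@le_lt_trans _ _
   ((\sum_(i <- K) `|complex.Re (x i)|)%:C + (\sum_(i <- K) `|complex.Im (x i)|)%:C)).
  rewrite -rmorphD -big_split /= rmorph_sum; apply: ler_sum => i _.
  rewrite normc_def lecR -(ler_pXn2r (_ : 0 < 2)%N) ?nnegrE ?addr_ge0 ?sqrtr_ge0//.
  rewrite sqr_sqrtr ?addr_ge0 ?sqr_ge0// sqrrD !real_normK ?num_real//.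
  by rewrite addrAC lerDl mulrn_wge0// mulr_ge0.
apply: ltrD.
  by apply: p1 => z; exact: normc_ge_Re.
apply: p2 => z; rewrite normc_def lecR -sqrtr_sqr.
by apply: ler_wsqrtr; rewrite lerDr sqr_ge0.
Qed.
End UnconditionalSums.

(** * Fourier expansions *)

#[local] Existing Instance totally_filter.

Section FourierExpansions.
Variable R : realType.
Local Notation C := R[i].
Local Notation toC := (map_mx (ratr : rat -> C)).
Local Notation toR := (map_mx (ratr : rat -> R)).

Definition qexp (N : 'M[rat]_2) (Z : 'M[C]_2) : C :=
  cexp (2 * (@pi R)%:C * 'i%C * \tr (toC N *m Z)).

Definition expands (f : 'M[C]_2 -> C) (c : 'M[rat]_2 -> C) : Prop :=
  forall Z, siegel_upper_half Z -> sums_to (fun N => c N * qexp N Z) (f Z).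

Lemma qexp_shift N Z X : qexp N (Z + toC X) = qexp N Z * uexp R (\tr (N *m X)).
Proof.
rewrite /qexp mulmxDr mxtraceD (mulrDr (2 * (@pi R)%:C * 'i%C)) cexpD.
by rewrite -map_mxM trace_map_mx.
Qed.

Lemma ratr_complex (q : rat) : (ratr q : C) = (ratr q : R)%:C.
Proof. by rewrite [RHS](fmorph_rat (real_complex R)). Qed.

Lemma Im_mul_ratr (z : C) (q : rat) : complex.Im (z * ratr q) = complex.Im z * ratr q.
Proof. by rewrite ratr_complex; case: z => x y /=; rewrite mulr0 add0r. Qed.

Lemma Im_sum (J : Type) (s : seq J) (x : J -> C) :
  complex.Im (\sum_(j <- s) x j) = \sum_(j <- s) complex.Im (x j).
Proof. exact: (raddf_sum (@complex.Im R : {additive Rcomplex R -> R})). Qed.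

Lemma Im_ratr_mx (A : 'M[rat]_2) (Z : 'M[C]_2) (B : 'M[rat]_2) :
  map_mx (@complex.Im R) (toC A *m Z *m toC B) =
  toR A *m map_mx (@complex.Im R) Z *m toR B.
Proof.
apply/matrixP => i j; rewrite !mxE Im_sum.
apply: eq_bigr => l _; rewrite !mxE Im_mul_ratr; congr (_ * _); rewrite Im_sum.
by apply: eq_bigr => k _; rewrite !mxE mulrC Im_mul_ratr mulrC.
Qed.

Lemma siegel_upper_half_transform (G X : 'M[rat]_2) (Z : 'M[C]_2) :
  G \in unitmx -> X^T = X -> siegel_upper_half Z ->
  siegel_upper_half ((toC G)^T *m Z *m toC G + toC X).
Proof.
move=> Gu Xs [Zs [Ys Yp]]; split.
  by rewrite linearD /= !trmx_mul trmxK Zs -mulmxA [(toC X)^T]map_trmx Xs.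
have -> : map_mx (@complex.Im R) ((toC G)^T *m Z *m toC G + toC X) =
    (toR G)^T *m map_mx (@complex.Im R) Z *m toR G.
  rewrite map_trmx [in RHS]map_trmx -Im_ratr_mx; apply/matrixP => i j; rewrite !mxE.
  by rewrite ratr_complex; case: (\sum_k _) => a b /=; rewrite addr0.
split; first by rewrite !trmx_mul trmxK Ys mulmxA.
move=> v v0; have := Yp (v *m (toR G)^T).
rewrite trmx_mul trmxK !mulmxA; apply.
apply: contra v0 => /eqP v0; rewrite -(mulmxK (_ : (toR G)^T \in unitmx) v) ?v0 ?mul0mx//.
by rewrite unitmx_tr map_unitmx.
Qed.

(** Since tr(T G^T Z G) = tr(G T G^T Z), the exponential at T turns into the one at N = G T G^T; the
    coefficient at N is thus read off at G^-1 N G^-T, and the translation by X contributes the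
    phase. *)
Lemma expands_transform f c (G X : 'M[rat]_2) :
  G \in unitmx -> X^T = X -> expands f c ->
  expands (fun Z => f ((toC G)^T *m Z *m toC G + toC X))
    (fun N => c (invmx G *m N *m (invmx G)^T) *
              uexp R (\tr (invmx G *m N *m (invmx G)^T *m X))).
Proof.
move=> Gu Xs hf Z HZ.
pose phi N : 'M[rat]_2 := invmx G *m N *m (invmx G)^T.
pose psi T : 'M[rat]_2 := G *m T *m G^T.
have GTu : G^T \in unitmx by rewrite unitmx_tr.
have phiK : cancel phi psi.
  by move=> N; rewrite /phi /psi trmx_inv !mulmxA mulmxV// mul1mx mulmxKV.
have psiK : cancel psi phi.
  by move=> N; rewrite /phi /psi trmx_inv !mulmxA mulVmx// mul1mx mulmxK.
have := sums_to_reindex phiK psiK (hf _ (siegel_upper_half_transform Gu Xs HZ)).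
congr (sums_to _ _); apply: funext => N; rewrite /= qexp_shift mulrCA mulrC.
congr (_ * _).
rewrite /qexp; congr (cexp (_ * _)).
rewrite mulmxA mulmxA mxtrace_mulC !mulmxA; congr (\tr (_ *m _)).
by rewrite -[in RHS](phiK N) /psi !map_mxM map_trmx.
Qed.

Lemma fourier_expansion_expands F (a : 'M[rat]_2 -> C) : fourier_expansion F a ->
  expands F (fun N => if N \in half_integral_psd R then a N else 0).
Proof.
move=> h Z HZ; have := cvg_sums_to (h Z HZ).
congr (sums_to _ _); apply: funext => N; rewrite /fourier_term.
by case: ifP => //; rewrite mul0r.
Qed.

Lemma expands_sum (J : Type) (s : seq J) (P : pred J) (f : J -> 'M[C]_2 -> C) c :
  (forall j, P j -> expands (f j) (c j)) ->
  expands (fun Z => \sum_(j <- s | P j) f j Z) (fun N => \sum_(j <- s | P j) c j N).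
Proof.
move=> h Z HZ; have := sums_to_sum s (fun j Pj => h j Pj Z HZ).
by congr (sums_to _ _); apply: funext => N; rewrite mulr_suml.
Qed.

Lemma expandsZ f c l : expands f c -> expands (fun Z => l * f Z) (fun N => l * c N).
Proof.
move=> h Z HZ; have := sums_toZ l (h Z HZ).
by congr (sums_to _ _); apply: funext => N; rewrite mulrA.
Qed.

Lemma expandsD f c g d : expands f c -> expands g d ->
  expands (fun Z => f Z + g Z) (fun N => c N + d N).
Proof.
move=> h k Z HZ; have := sums_toD (h Z HZ) (k Z HZ).
by congr (sums_to _ _); apply: funext => N; rewrite mulrDl.
Qed.

Lemma expands_ext f g c : (forall Z, siegel_upper_half Z -> f Z = g Z) ->
  expands f c -> expands g c.
Proof. by move=> fg h Z HZ; rewrite -fg//; exact: h. Qed.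

(** Nondegeneracy of the trace form on symmetric matrices. The value 1/2 is chosen to make exp(2 pi
    i tr(N X)) equal to -1. *)
Lemma half_trace_dual (N : 'M[rat]_2) : N^T = N -> N != 0 ->
  exists2 X : 'M[rat]_2, X^T = X & \tr (N *m X) = 2^-1.
Proof.
move=> Ns N0.
have N10 : N 1 0 = N 0 1 by rewrite -[in LHS]Ns mxE.
have trE X : \tr (N *m X) = N 0 0 * X 0 0 + N 0 1 * X 1 0 + N 0 1 * X 0 1 + N 1 1 * X 1 1.
  rewrite /mxtrace !big_ord_recl !big_ord0 !mxE !big_ord_recl !big_ord0 /=.
  rewrite !addr0 (_ : lift ord0 ord0 = 1); last exact/val_inj.
  by rewrite N10 !addrA.
have mxs (x y z : rat) : (mx22 x y y z)^T = mx22 x y y z.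
  by apply/matrixP => i j; rewrite !mxE; case: eqP; case: eqP.
have [a0|a0] := eqVneq (N 0 0) 0; last first.
  by exists (mx22 (2 * N 0 0)^-1 0 0 0) => //; rewrite trE !mxE /=; field.
have [d0|d0] := eqVneq (N 1 1) 0; last first.
  by exists (mx22 0 0 0 (2 * N 1 1)^-1) => //; rewrite trE !mxE /=; field.
have b0 : N 0 1 != 0.
  apply: contra N0 => /eqP b0; apply/eqP/matrixP => i j; rewrite mxE.
  by case: (splitP (i : 'I_(1 + 1))) => i' /=; case: (splitP (j : 'I_(1 + 1))) => j' /=;
   rewrite !ord1 => /= jE iE;
   [rewrite -a0|rewrite -b0|rewrite -b0 -N10|rewrite -d0]; congr (N _ _); exact: val_inj.
by exists (mx22 0 (4 * N 0 1)^-1 (4 * N 0 1)^-1 0) => //; rewrite trE !mxE /=; field.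
Qed.

(* Averaging a translate of f against f multiplies the coefficient at M by
   (1 + e(tr ((M - N0) X))) / 2, which can be made to vanish at a given M. *)
Lemma null_expansion_kill c (N0 N : 'M[rat]_2) : expands (fun=> 0) c ->
  N0^T = N0 -> N^T = N -> N != N0 ->
  exists c', [/\ expands (fun=> 0) c', c' N0 = c N0, c' N = 0
               & forall M, `|c' M| <= `|c M|].
Proof.
move=> h N0s Ns NN0.
have [X Xs XE] : exists2 X : 'M[rat]_2, X^T = X & \tr ((N - N0) *m X) = 2^-1.
  by apply: half_trace_dual; rewrite ?linearB /= ?Ns ?N0s// subr_eq0.
exists (fun M => (1 + uexp R (\tr ((M - N0) *m X))) / 2 * c M); split.
- have h1 := expandsZ (uexp R (- \tr (N0 *m X))) (expands_transform (unitmx1 _ _) Xs h).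
  have := expandsZ 2^-1 (expandsD h h1).
  rewrite mulr0 addr0 mulr0; congr (expands _ _); apply: funext => M.
  rewrite invmx1 trmx1 mul1mx mulmx1 mulmxBl raddfB /= addrC uexpD.
  by field.
- rewrite subrr mul0mx linear0 uexp0.
  by rewrite -[1 + 1]/(2%:R) divff ?mul1r// pnatr_eq0.
- by rewrite XE uexp_half subrr !mul0r.
- move=> M; rewrite normrM ler_piMl// normrM normfV normr_nat ler_pdivrMr// mul1r.
  by apply: le_trans (ler_normD _ _) _; rewrite normr1 norm_uexp.
Qed.

(** Indices are killed one at a time; since moduli never increase, a coefficient already killed
    stays zero. *)
Lemma null_expansion_kill_seq c (N0 : 'M[rat]_2) (s : seq 'M[rat]_2) :
  expands (fun=> 0) c -> N0^T = N0 ->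
  (forall N, N \in s -> N^T = N /\ N != N0) ->
  exists c', [/\ expands (fun=> 0) c', c' N0 = c N0, forall N, N \in s -> c' N = 0
               & forall M, `|c' M| <= `|c M|].
Proof.
move=> h N0s; elim: s => [|N s IH] hs; first by exists c.
have [|c' [h' c'0 c's c'le]] := IH; first by move=> M Ms; apply: hs; rewrite inE Ms orbT.
have [|Ns NN0] := hs N; first by rewrite inE eqxx.
have [d [hd d0 dN dle]] := null_expansion_kill h' N0s Ns NN0.
exists d; split=> [//||M|M]; first by rewrite d0.
- rewrite inE => /orP[/eqP->//|/c's cM].
  by apply/eqP; rewrite -normr_le0; apply: le_trans (dle M) _; rewrite cM normr0.
- exact: le_trans (dle M) (c'le M).
Qed.

Lemma siegel_upper_half_i : siegel_upper_half ('i%C%:M : 'M[C]_2).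
Proof.
split; first by rewrite tr_scalar_mx.
have -> : map_mx (@complex.Im R) ('i%C%:M : 'M[C]_2) = 1%:M :> 'M[R]_2.
  by apply/matrixP => i j; rewrite !mxE; case: (i == j).
split=> [|v v0]; first by rewrite trmx1.
rewrite mulmx1 mxE; apply: contraT; rewrite -leNgt => h.
have : \sum_j v 0 j * v^T j 0 = 0.
  by apply/eqP; rewrite eq_le h sumr_ge0// => j _; rewrite mxE -expr2 sqr_ge0.
move/eqP; rewrite psumr_eq0 => [/allP hv|j _]; last by rewrite mxE -expr2 sqr_ge0.
case/negP: v0; apply/eqP/matrixP => i j; rewrite ord1 mxE.
have := hv j (mem_index_enum _); rewrite mxE -expr2 sqrf_eq0 => /eqP.
exact.
Qed.

(** Outside a finite set J the terms at Z = i I have total modulus below e. Killing the symmetric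
    indices of J other than N0 preserves both this bound and the coefficient at N0, so the vanishing
    sum leaves a term at N0 of modulus at most 2 e. The support must be symmetric because tr(N Z)
    sees only the symmetric part of N. *)
Lemma null_expansion c (N0 : 'M[rat]_2) : expands (fun=> 0) c ->
  (forall N, N^T != N -> c N = 0) -> c N0 = 0.
Proof.
move=> h cs; have [N0s|/cs//] := eqVneq (N0^T) N0.
pose Z := 'i%C%:M : 'M[C]_2; have HZ : siegel_upper_half Z := siegel_upper_half_i.
suff small e : 0 < e -> `|c N0 * qexp N0 Z| <= e * 2.
  apply/eqP; rewrite -(mulIr_eq0 _ (mulIf (cexp_neq0 (2 * (@pi R)%:C * 'i%C * \tr (toC N0 *m Z))))).
  rewrite -normr_le0; apply/ler_addgt0Pr => e e0; rewrite add0r.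
  by rewrite -[leRHS](divfK (_ : 2 != 0)) ?pnatr_eq0//; apply: small; rewrite divr_gt0.
move=> e0; have [J hJ] := sums_to_norm_tail (h Z HZ) e0.
have [|c' [h' c'0 c'J c'le]] := @null_expansion_kill_seq c N0
    [seq N <- J | (N^T == N) && (N != N0)] h N0s.
  by move=> N; rewrite mem_filter => /andP[/andP[/eqP]].
have [A hA] := h' Z HZ e e0.
have := hA (N0 |` A)%fset (fsubsetUr _ _).
rewrite (@big_fsetD1 _ _ _ _ N0)/= ?fset1U1// c'0 sub0r normrN.
set x := c N0 * _; set y := \sum_(i <- _) _ => hxy.
have hy : `|y| <= e.
  rewrite /y; set K := (_ `\ _)%fset.
  rewrite (bigID (fun N => N \in J))/= big1_seq ?add0r => [|N /andP[NJ NK]]; last first.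
    have [Ns|Ns] := eqVneq (N^T) N.
      rewrite c'J ?mul0r// mem_filter Ns eqxx NJ /=.
      by move: NK; rewrite !inE => /andP[->].
    have : `|c' N| <= 0 by rewrite -(normr0 C) -(cs N Ns).
    by rewrite normr_le0 => /eqP ->; rewrite mul0r.
  apply: le_trans (ler_norm_sum _ _ _) _.
  rewrite big_fset_condE /=.
  apply: le_trans (ltW (hJ [fset i in K | i \notin J]%fset _)).
    by apply: ler_sum => N _; rewrite !normrM ler_wpM2r.
  apply/fdisjointP => N NJ; rewrite !inE NJ andbF//.
rewrite (_ : x = (x + y) - y); last by rewrite addrK.
apply: le_trans (ler_normB _ _) _; rewrite mulr_natr mulr2n.
by apply: lerD => //; exact: ltW.
Qed.

Lemma expands_uniq f c d (N : 'M[rat]_2) : expands f c -> expands f d ->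
  (forall N, N^T != N -> c N = 0) -> (forall N, N^T != N -> d N = 0) -> c N = d N.
Proof.
move=> hc hd cs ds; apply/eqP; rewrite -subr_eq0; apply/eqP.
apply: (@null_expansion (fun N => c N - d N)) => [|M Ms]; last by rewrite cs// ds// subr0.
have := expandsD hc (expandsZ (-1) hd).
have -> : (fun Z => f Z + -1 * f Z) = fun=> 0.
  by apply: funext => Z; rewrite mulN1r subrr.
by congr (expands _ _); apply: funext => M; rewrite mulN1r.
Qed.

End FourierExpansions.

(** * Integral symplectic similitudes *)

Section Mx22.

Lemma mx22P (K : Type) (A B : 'M[K]_2) :
  [/\ A 0 0 = B 0 0, A 0 1 = B 0 1, A 1 0 = B 1 0 & A 1 1 = B 1 1] -> A = B.
Proof.
case=> h00 h01 h10 h11; apply/matrixP => i j.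
have e2 (l : 'I_2) : l = 0 \/ l = 1.
  by case: l => [[|[|l]] hl] //; [left|right]; exact: val_inj.
by case: (e2 i) => ->; case: (e2 j) => ->.
Qed.

Lemma mx22_eta (K : Type) (A : 'M[K]_2) : A = mx22 (A 0 0) (A 0 1) (A 1 0) (A 1 1).
Proof. by apply: mx22P; rewrite !mxE. Qed.

Lemma mx22_inj (K : Type) (a b c d a' b' c' d' : K) :
  mx22 a b c d = mx22 a' b' c' d' -> [/\ a = a', b = b', c = c' & d = d'].
Proof.
move=> /matrixP h; split; [have := h 0 0|have := h 0 1|have := h 1 0|have := h 1 1];
by rewrite !mxE.
Qed.

Lemma sum2E (V : nmodType) (f : 'I_2 -> V) : \sum_i f i = f 0 + f 1.
Proof.
rewrite big_ord_recl big_ord_recl big_ord0 addr0; congr (_ + f _).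
exact: val_inj.
Qed.

Section Ring.
Variable K : comNzRingType.
Implicit Types a b c d : K.

Lemma mul_mx22 a b c d a' b' c' d' : mx22 a b c d *m mx22 a' b' c' d' =
  mx22 (a * a' + b * c') (a * b' + b * d') (c * a' + d * c') (c * b' + d * d').
Proof. by apply: mx22P; rewrite !mxE !sum2E !mxE. Qed.

Lemma add_mx22 a b c d a' b' c' d' : mx22 a b c d + mx22 a' b' c' d' =
  mx22 (a + a') (b + b') (c + c') (d + d').
Proof. by apply: mx22P; rewrite !mxE. Qed.

Lemma opp_mx22 a b c d : - mx22 a b c d = mx22 (- a) (- b) (- c) (- d).
Proof. by apply: mx22P; rewrite !mxE. Qed.

Lemma scale_mx22 l a b c d : l *: mx22 a b c d = mx22 (l * a) (l * b) (l * c) (l * d).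
Proof. by apply: mx22P; rewrite !mxE. Qed.

Lemma scalar_mx22 a : a%:M = mx22 a 0 0 a.
Proof. by apply: mx22P; rewrite !mxE. Qed.

Lemma mx22_0 : 0 = mx22 0 0 0 0 :> 'M[K]_2.
Proof. by apply: mx22P; rewrite !mxE. Qed.

Lemma tr_mx22 a b c d : (mx22 a b c d)^T = mx22 a c b d.
Proof. by apply: mx22P; rewrite !mxE. Qed.

Lemma det_mx22 a b c d : \det (mx22 a b c d) = a * d - b * c.
Proof.
rewrite (expand_det_row _ 0) sum2E /cofactor !det_mx11 !mxE /=.
by rewrite expr0 expr1 mul1r mulN1r mulrN.
Qed.

Lemma mxtrace_mx22 a b c d : \tr (mx22 a b c d) = a + d.
Proof. by rewrite /mxtrace sum2E !mxE. Qed.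

End Ring.

Lemma map_mx22 (K L : Type) (f : K -> L) a b c d :
  map_mx f (mx22 a b c d) = mx22 (f a) (f b) (f c) (f d).
Proof. by apply: mx22P; rewrite !mxE. Qed.

End Mx22.

(** The elimination step: an element of SL_2(Z) clears the second entry of the column (x, y). Its
    first row consists of Bezout coefficients, its second of (-y, x) divided by the gcd. *)
Lemma bezout_sl2 (x y : int) :
  exists s t u v : int, s * v - t * u = 1 /\ u * x + v * y = 0.
Proof.
have [x0|x0] := eqVneq x 0; first by exists 0, (-1), 1, 0; rewrite x0; split; ring.
have g0 : gcdz x y != 0 by rewrite gcdz_eq0 negb_and x0.
have [s [t e]] := Bezoutz x y.
have /dvdzP[x' xE] := dvdz_gcdl x y; have /dvdzP[y' yE] := dvdz_gcdr x y.
move: g0 e xE yE; move: (gcdz x y) => g g0 e xE yE.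
exists s, t, (- y'), x'; split; last by rewrite xE yE; ring.
by apply: (mulIf g0); rewrite mul1r -[RHS]e xE yE; ring.
Qed.

Section Similitudes.
Implicit Types (A B C D U V S : 'M[int]_2) (g h : 'M[int]_(2 + 2)).

Lemma similitude_block (mu : nat) A B C D :
  similitude mu (block_mx A B C D) <->
  [/\ A^T *m C = C^T *m A, A^T *m D - C^T *m B = mu%:R%:M & B^T *m D = D^T *m B].
Proof.
rewrite /similitude /= /symplectic_J tr_block_mx !mulmx_block !mulmx0 !mulmx1 !add0r !addr0.
rewrite !mulmxN !mulmx1 !mulNmx scale_block_mx !scaler0 scalerN.
rewrite scale_scalar_mx mulr1.
rewrite [_ + A^T *m C]addrC [- (C^T *m B) + _]addrC [- (D^T *m B) + _]addrC.
split=> [/eq_block_mx[h1 h2 _ h4]|[h1 h2 h3]].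
  by split=> //; apply/eqP; rewrite -subr_eq0; apply/eqP.
rewrite h1 h3 h2 !subrr; congr block_mx.
have <- : D^T *m A - B^T *m C = mu%:R%:M.
  by rewrite -tr_scalar_mx -h2 linearB /= !trmx_mul !trmxK.
by rewrite opprB addrC.
Qed.

Lemma similitudeM mu nu g h :
  similitude mu g -> similitude nu h -> similitude (mu * nu) (g *m h).
Proof.
rewrite /similitude /= => hg hh.
rewrite (_ : _ *m (g *m h) = h^T *m (g^T *m symplectic_J *m g) *m h); last first.
  by rewrite trmx_mul !mulmxA.
by rewrite hg -scalemxAr -scalemxAl hh scalerA natrM.
Qed.

Lemma Sp4ZM g h : Sp4Z g -> Sp4Z h -> Sp4Z (g *m h).
Proof. exact: (@similitudeM 1 1). Qed.

Lemma Sp4Z1 : Sp4Z 1%:M.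
Proof. by rewrite /Sp4Z /similitude /= trmx1 mul1mx mulmx1 scale1r. Qed.

Lemma symplectic_J2 : symplectic_J *m symplectic_J = - 1%:M.
Proof.
rewrite /symplectic_J mulmx_block !mul0mx !mul1mx !mulmx0 !addr0 !add0r mulmx1.
by rewrite [in RHS]scalar_mx_block opp_block_mx !oppr0.
Qed.

Lemma Sp4Z_inv g : Sp4Z g -> exists g', [/\ Sp4Z g', g' *m g = 1%:M & g *m g' = 1%:M].
Proof.
rewrite /Sp4Z /similitude /= scale1r => hg.
have gV : (- symplectic_J *m g^T *m symplectic_J) *m g = 1%:M.
  by rewrite -!mulmxA (mulmxA g^T) hg mulNmx symplectic_J2 opprK.
have Vg := mulmx1C gV.
exists (- symplectic_J *m g^T *m symplectic_J); split=> //.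
set g' := _ *m symplectic_J in gV Vg *; clearbody g'.
rewrite -{1}hg (_ : _ *m g' = (g *m g')^T *m symplectic_J *m (g *m g')).
  by rewrite Vg trmx1 mul1mx mulmx1.
by rewrite trmx_mul !mulmxA.
Qed.

Lemma Sp4Z_unimodular U V : U^T *m V = 1%:M -> Sp4Z (block_mx U 0 0 V).
Proof.
move=> UV; apply/similitude_block; rewrite !trmx0 !mulmx0 !mul0mx UV subr0.
by split.
Qed.

Lemma Sp4Z_shear S : S^T = S -> Sp4Z (block_mx 1%:M S 0 1%:M).
Proof.
by move=> Ss; apply/similitude_block; rewrite trmx0 trmx1 !mulmx0 !mul0mx !mulmx1 mul1mx subr0 Ss.
Qed.

(** This and the next lemma give the two standard copies of SL_2(Z), acting on the first and on the
    second pair of symplectic coordinates. With the unimodular blocks they do all the elimination in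
    [similitude_reduce_lower]. *)
Lemma Sp4Z_sl2_1 s t u v : s * v - t * u = 1 ->
  Sp4Z (block_mx (mx22 s 0 0 1) (mx22 t 0 0 0) (mx22 u 0 0 0) (mx22 v 0 0 1)).
Proof.
move=> e; apply/similitude_block; rewrite !tr_mx22 !mul_mx22 opp_mx22 add_mx22.
rewrite scalar_mx22 !(mulr0, mul0r, addr0, add0r, subr0, mulr1).
by rewrite [u * t]mulrC e; split=> //; congr mx22; ring.
Qed.

Lemma Sp4Z_sl2_2 s t u v : s * v - t * u = 1 ->
  Sp4Z (block_mx (mx22 1 0 0 s) (mx22 0 0 0 t) (mx22 0 0 0 u) (mx22 1 0 0 v)).
Proof.
move=> e; apply/similitude_block; rewrite !tr_mx22 !mul_mx22 opp_mx22 add_mx22.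
rewrite scalar_mx22 !(mulr0, mul0r, addr0, add0r, subr0, mulr1).
by rewrite [u * t]mulrC e; split=> //; congr mx22; ring.
Qed.

Definition Sp4Z_coset h : set 'M[int]_(2 + 2) := [set g *m h | g in Sp4Z].

Lemma Sp4Z_coset_refl h : Sp4Z_coset h h.
Proof. by exists 1%:M; [exact: Sp4Z1 | rewrite mul1mx]. Qed.

Lemma Sp4Z_cosetMl g h : Sp4Z g -> Sp4Z_coset (g *m h) = Sp4Z_coset h.
Proof.
move=> hg; apply/seteqP; split=> [_ [x hx <-]|_ [x hx <-]].
  by exists (x *m g); [exact: Sp4ZM | rewrite mulmxA].
have [g' [hg' g'g _]] := Sp4Z_inv hg.
by exists (x *m g'); [exact: Sp4ZM | rewrite !mulmxA -(mulmxA x) g'g mulmx1].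
Qed.

Definition Sp4Z_equiv h h' := exists2 g, Sp4Z g & h' = g *m h.

Lemma Sp4Z_equiv_trans h1 h2 h3 :
  Sp4Z_equiv h1 h2 -> Sp4Z_equiv h2 h3 -> Sp4Z_equiv h1 h3.
Proof.
move=> [g hg ->] [g' hg' ->]; exists (g' *m g); first exact: Sp4ZM.
by rewrite mulmxA.
Qed.

Lemma Sp4Z_equiv_similitude mu h h' :
  Sp4Z_equiv h h' -> similitude mu h -> similitude mu h'.
Proof. by move=> [g hg ->] hh; rewrite -[mu]mul1n; exact: similitudeM. Qed.

Lemma Sp4Z_equiv_coset h h' : Sp4Z_equiv h h' -> Sp4Z_coset h' = Sp4Z_coset h.
Proof. by move=> [g hg ->]; exact: Sp4Z_cosetMl. Qed.

(** The copies of SL_2 clear the first column of C, and a unimodular block then clears the entry A 1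
    0. The symplectic relations now force C 0 1 = 0, and a last step in the second coordinates
    clears C 1 1; it leaves the first column of C alone because A 1 0 and C 1 0 both vanish. *)
Lemma similitude_reduce_lower mu h : (0 < mu)%N -> similitude mu h ->
  exists A B D, Sp4Z_equiv h (block_mx A B 0 D).
Proof.
move=> mu0 hh.
have step1 (A B C D : 'M[int]_2) : exists A' B' C' D',
    [/\ Sp4Z_equiv (block_mx A B C D) (block_mx A' B' C' D'), C' 0 0 = 0
      & C' 1 = C 1 /\ A' 1 = A 1].
  have [s [t [u [v [e1 e2]]]]] := bezout_sl2 (A 0 0) (C 0 0).
  exists (mx22 s 0 0 1 *m A + mx22 t 0 0 0 *m C), (mx22 s 0 0 1 *m B + mx22 t 0 0 0 *m D).
  exists (mx22 u 0 0 0 *m A + mx22 v 0 0 1 *m C), (mx22 u 0 0 0 *m B + mx22 v 0 0 1 *m D).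
  split.
  - by eexists; [exact: (Sp4Z_sl2_1 e1) | rewrite mulmx_block].
  - by rewrite !mxE !sum2E !mxE /= !mul0r !addr0.
  - by split; apply: funext => j; rewrite !mxE !sum2E !mxE /=; ring.
have step2 (A B C D : 'M[int]_2) l : exists A' B' C' D',
    [/\ Sp4Z_equiv (block_mx A B C D) (block_mx A' B' C' D'), C' 1 l = 0,
        (A 1 0 = 0 -> C 1 0 = 0 -> C' 1 0 = 0)
      & C' 0 = C 0 /\ A' 0 = A 0].
  have [s [t [u [v [e1 e2]]]]] := bezout_sl2 (A 1 l) (C 1 l).
  exists (mx22 1 0 0 s *m A + mx22 0 0 0 t *m C), (mx22 1 0 0 s *m B + mx22 0 0 0 t *m D).
  exists (mx22 0 0 0 u *m A + mx22 1 0 0 v *m C), (mx22 0 0 0 u *m B + mx22 1 0 0 v *m D).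
  split.
  - by eexists; [exact: (Sp4Z_sl2_2 e1) | rewrite mulmx_block].
  - by rewrite !mxE !sum2E !mxE /= !mul0r !add0r.
  - by move=> a0 c0; rewrite !mxE !sum2E !mxE /= a0 c0; ring.
  - by split; apply: funext => j; rewrite !mxE !sum2E !mxE /=; ring.
rewrite -(submxK h) in hh *.
move: (ulsubmx h) (ursubmx h) (dlsubmx h) (drsubmx h) hh => A0 B0 C0 D0 hh.
have [A1 [B1 [C1 [D1 [q1 c1 _]]]]] := step1 A0 B0 C0 D0.
have [A2 [B2 [C2 [D2 [q2 c2 _ [c2' a2]]]]]] := step2 A1 B1 C1 D1 0.
have [s [t [u [v [e1 e2]]]]] := bezout_sl2 (A2 0 0) (A2 1 0).
have UV : (mx22 s t u v)^T *m mx22 v (- u) (- t) s = 1%:M.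
  rewrite tr_mx22 mul_mx22 scalar_mx22; congr mx22; rewrite -?e1; ring.
set U := mx22 s t u v in UV; set V := mx22 v _ _ _ in UV.
pose A3 := U *m A2; pose B3 := U *m B2; pose C3 := V *m C2; pose D3 := V *m D2.
have q3 : Sp4Z_equiv (block_mx A2 B2 C2 D2) (block_mx A3 B3 C3 D3).
  exists (block_mx U 0 0 V); first exact: Sp4Z_unimodular.
  by rewrite mulmx_block !mul0mx !addr0 !add0r.
have a3 : A3 1 0 = 0 by rewrite !mxE !sum2E !mxE.
have c30 : C3 0 0 = 0 by rewrite !mxE !sum2E !mxE /= c2' c1 c2; ring.
have c31 : C3 1 0 = 0 by rewrite !mxE !sum2E !mxE /= c2' c1 c2; ring.
clearbody A3 B3 C3 D3.
have /similitude_block[h1 h2 _] := Sp4Z_equiv_similitude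
  (Sp4Z_equiv_trans (Sp4Z_equiv_trans q1 q2) q3) hh.
(* Otherwise the first column of the whole matrix would vanish, whereas the (0, 0) entry of A^T D -
   C^T B is mu. *)
have a00 : A3 0 0 != 0.
  apply/eqP => a0; have /matrixP/(_ 0 0) := h2.
  rewrite !mxE !sum2E !mxE a0 a3 c30 c31 !(mul0r, addr0, add0r, oppr0) /= => /eqP.
  by rewrite mulr1n eq_sym pnatr_eq0 gtn_eqF.
(* The (0, 1) entry of A^T C = C^T A reduces to A 0 0 * C 0 1 = 0. *)
have c3' : C3 0 1 = 0.
  have /matrixP/(_ 0 1) := h1; rewrite !mxE !sum2E !mxE a3 c30 c31 !mul0r !addr0 => /eqP.
  by rewrite mulf_eq0 (negbTE a00) => /eqP.
have [A4 [B4 [C4 [D4 [q4 c4 c4' [c4'' _]]]]]] := step2 A3 B3 C3 D3 1.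
exists A4, B4, D4; have -> : 0 = C4.
  by apply: mx22P; rewrite c4'' c30 c3' c4 c4'// !mxE.
exact: Sp4Z_equiv_trans (Sp4Z_equiv_trans (Sp4Z_equiv_trans q1 q2) q3) q4.
Qed.

End Similitudes.

(** * Reduced triangular representatives of the cosets of multiplier n *)

Section HeckeReps.

(** For D = [[a, b], [0, d]], the divisibilities say that n D^-1, with entries n/a, -nb/(ad), 0 and
    n/d, is integral; [b < d] is the Hermite condition. *)
Definition good_denom (n a b d : nat) : bool :=
  [&& (a %| n)%N, (d %| n)%N, (a * d %| n * b)%N & (b < d)%N].

(** The entries of Q are residues modulo n, and n divides all four entries of Q D. *)
Definition good_shift (n a b d x y z : nat) : bool :=
  [&& (x < n)%N, (y < n)%N, (z < n)%N, (n %| x * a)%N, (n %| x * b + y * d)%N,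
      (n %| y * a)%N & (n %| y * b + z * d)%N].

(* [[A, Q D / n], [0, D]] with D = [[a, b], [0, d]], A = n D^-T and
   Q = [[x, y], [y, z]]; all the divisions are exact. *)
Definition hecke_rep (n a b d x y z : nat) : 'M[int]_(2 + 2) :=
  block_mx
    (mx22 (n %/ a)%N%:Z 0 (- (n * b %/ (a * d))%N%:Z) (n %/ d)%N%:Z)
    (mx22 (x * a %/ n)%N%:Z ((x * b + y * d) %/ n)%N%:Z
          (y * a %/ n)%N%:Z ((y * b + z * d) %/ n)%N%:Z)
    0 (mx22 a%:Z b%:Z 0 d%:Z).

Lemma exact_divn (u : int) (m k : nat) : (0 < k)%N -> u * k%:Z = m%:Z ->
  (k %| m)%N /\ u = (m %/ k)%N%:Z.
Proof.
move=> k0; case: u => u e; last by move: e; rewrite NegzE; lia.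
have <- : (u * k)%N = m by lia.
by rewrite mulnK// dvdn_mull.
Qed.

Lemma range_eq (n x y : nat) (q : int) : (x < n)%N -> (y < n)%N ->
  x%:Z = y%:Z + n%:Z * q -> x = y /\ q = 0.
Proof.
move=> xn yn e.
have [q0|q0|q0] := ltrgt0P q; last by rewrite q0 in e; split => //; lia.
  have : n%:Z <= n%:Z * q by rewrite -[leLHS]mulr1 ler_wpM2l//; lia.
  lia.
have : n%:Z * q <= - n%:Z by rewrite -mulrN1 ler_wpM2l//; lia.
lia.
Qed.

Lemma int_unit1 (p s : int) : p * s = 1 -> 0 < s -> s = 1 /\ p = 1.
Proof.
move=> ps s0; have p0 : 0 < p by rewrite -(pmulr_lgt0 _ s0) ps.
have p1 : p = 1 by nia.
by move: ps; rewrite p1 mul1r => ->.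
Qed.

Lemma good_denom_gt0 n a b d : (0 < n)%N -> good_denom n a b d -> (0 < a)%N /\ (0 < d)%N.
Proof. by move=> n0 /and4P[an dn _ _]; split; [exact: dvdn_gt0 an|exact: dvdn_gt0 dn]. Qed.

Lemma good_denomE n a b d : (0 < n)%N -> good_denom n a b d ->
  [/\ (n %/ a)%N%:Z * a%:Z = n%:Z, (n %/ d)%N%:Z * d%:Z = n%:Z
    & (n * b %/ (a * d))%N%:Z * d%:Z = (n %/ a)%N%:Z * b%:Z].
Proof.
move=> n0 g; have [a0 d0] := good_denom_gt0 n0 g; case/and4P: g => an dn adn _.
have e1 : (n %/ a)%N%:Z * a%:Z = n%:Z by rewrite -PoszM divnK.
have e2 : (n %/ d)%N%:Z * d%:Z = n%:Z by rewrite -PoszM divnK.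
have e3 : (n * b %/ (a * d))%N%:Z * (a%:Z * d%:Z) = n%:Z * b%:Z by rewrite -!PoszM divnK.
split=> //; have az : a%:Z != 0 by lia.
by apply: (mulfI az); rewrite mulrCA e3 -e1; ring.
Qed.

Lemma good_shiftE n a b d x y z : good_shift n a b d x y z ->
  [/\ (x * a %/ n)%N%:Z * n%:Z = x%:Z * a%:Z,
      ((x * b + y * d) %/ n)%N%:Z * n%:Z = x%:Z * b%:Z + y%:Z * d%:Z,
      (y * a %/ n)%N%:Z * n%:Z = y%:Z * a%:Z
    & ((y * b + z * d) %/ n)%N%:Z * n%:Z = y%:Z * b%:Z + z%:Z * d%:Z].
Proof.
case/and5P=> _ _ _ h1 /and3P[h2 h3 h4].
by rewrite -!PoszM !divnK// !PoszD !PoszM.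
Qed.

Lemma hecke_rep_similitude n a b d x y z : (0 < n)%N ->
  good_denom n a b d -> good_shift n a b d x y z ->
  similitude n (hecke_rep n a b d x y z).
Proof.
move=> n0 gD gS; have [e1 e2 e3] := good_denomE n0 gD.
have [f1 f2 f3 f4] := good_shiftE gS.
apply/similitude_block; rewrite trmx0 !mulmx0 !mul0mx subr0 !tr_mx22 !mul_mx22.
rewrite scalar_mx22; split=> //.
  by congr mx22; rewrite ?mulr0 ?mul0r ?addr0 ?add0r// ?e1 ?e2 -?pmulrn ?natz// mulNr e3 subrr.
have nz : n%:Z != 0 by lia.
move: f1 f2 f3 f4; set B1 := (x * a %/ n)%N%:Z; set B2 := ((x * b + y * d) %/ n)%N%:Z.
set B3 := (y * a %/ n)%N%:Z; set B4 := ((y * b + z * d) %/ n)%N%:Z => f1 f2 f3 f4.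
have e : B1 * b%:Z + B3 * d%:Z = a%:Z * B2.
  apply: (mulIf nz); rewrite -mulrA f2 mulrDl ![_ * _%:Z * n%:Z]mulrAC f1 f3; ring.
by congr mx22; rewrite ?mulr0 ?addr0 ?e //; [ring | rewrite mulrC -e; ring | ring].
Qed.

(** Multiplication by diag(U, U^-T) performs row operations on D and brings it to Hermite normal
    form. A shear by S adds S D to B, so it changes Q = n B D^-1 by n S and reduces Q modulo n. The
    block A is then determined by A^T D = n. *)
Lemma hecke_rep_exists n h : (0 < n)%N -> similitude n h ->
  exists a b d x y z, [/\ good_denom n a b d, good_shift n a b d x y z
                        & Sp4Z_equiv h (hecke_rep n a b d x y z)].
Proof.
move=> n0 hh.
have gl (A B D U V : 'M[int]_2) : U^T *m V = 1%:M ->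
    Sp4Z_equiv (block_mx A B 0 D) (block_mx (U *m A) (U *m B) 0 (V *m D)).
  move=> UV; exists (block_mx U 0 0 V); first exact: Sp4Z_unimodular.
  by rewrite mulmx_block !mul0mx !mulmx0 !addr0 !add0r.
have [A0 [B0 [D0 q0]]] := similitude_reduce_lower n0 hh.
have [A1 [B1 [D1 [q1 D1e]]]] : exists A B D,
    Sp4Z_equiv h (block_mx A B 0 D) /\ D 1 0 = 0.
  have [s [t [u [v [e1 e2]]]]] := bezout_sl2 (D0 0 0) (D0 1 0).
  have UV : (mx22 v (- u) (- t) s)^T *m mx22 s t u v = 1%:M.
    by rewrite tr_mx22 mul_mx22 scalar_mx22; congr mx22; rewrite -?e1; ring.
  do 3 eexists; split; first exact: Sp4Z_equiv_trans q0 (gl _ _ _ _ _ UV).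
  by rewrite !mxE !sum2E !mxE.
have d1 : D1 0 0 != 0 /\ D1 1 1 != 0.
  have detD : \det D1 = D1 0 0 * D1 1 1.
    by rewrite {1}[D1]mx22_eta det_mx22 D1e mulr0 subr0.
  have /similitude_block[_ h2 _] := Sp4Z_equiv_similitude q1 hh.
  move: h2; rewrite trmx0 mul0mx subr0 => /(congr1 determinant).
  rewrite det_mulmx det_scalar detD => e.
  have /eqP : D1 0 0 * D1 1 1 <> 0.
    by move=> E; move: e; rewrite E mulr0 => /esym/eqP; rewrite expf_eq0 /= pnatr_eq0; lia.
  by rewrite mulf_eq0 => /norP[].
have [A2 [B2 [D2 [q2 D2e d2 d2']]]] : exists A B D,
    [/\ Sp4Z_equiv h (block_mx A B 0 D), D 1 0 = 0, 0 < D 0 0 & 0 < D 1 1].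
  have ss (i : int) : Num.sg i * i = `|i| by rewrite normrEsg.
  have s2 (i : int) : i != 0 -> Num.sg i * Num.sg i = 1 by move=> i0; rewrite -expr2 sqr_sg i0.
  pose V := mx22 (Num.sg (D1 0 0)) 0 0 (Num.sg (D1 1 1)).
  have UV : V^T *m V = 1%:M.
    by rewrite tr_mx22 mul_mx22 scalar_mx22 !mulr0 !mul0r !addr0 !add0r !s2//; case: d1.
  do 3 eexists; split; first exact: Sp4Z_equiv_trans q1 (gl _ _ _ _ _ UV).
  - by rewrite !mxE !sum2E !mxE /= D1e; ring.
  - by rewrite !mxE !sum2E !mxE /= D1e mulr0 addr0 ss normr_gt0; case: d1.
  - by rewrite !mxE !sum2E !mxE /= mul0r add0r ss normr_gt0; case: d1.
have [A3 [B3 [D3 [q3 D3e d3 d3' b3]]]] : exists A B D,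
    [/\ Sp4Z_equiv h (block_mx A B 0 D), D 1 0 = 0, 0 < D 0 0, 0 < D 1 1
      & 0 <= D 0 1 < D 1 1].
  pose q := - divz (D2 0 1) (D2 1 1).
  have UV : (mx22 1 0 (- q) 1)^T *m mx22 1 q 0 1 = 1%:M.
    by rewrite tr_mx22 mul_mx22 scalar_mx22; congr mx22; ring.
  do 3 eexists; split; first exact: Sp4Z_equiv_trans q2 (gl _ _ _ _ _ UV).
  - by rewrite !mxE !sum2E !mxE /= D2e; ring.
  - by rewrite !mxE !sum2E !mxE /= D2e mulr0 addr0 mul1r.
  - by rewrite !mxE !sum2E !mxE /= mul0r add0r mul1r.
  - rewrite !mxE !sum2E !mxE /= mul0r add0r !mul1r /q.
    have -> : D2 0 1 + - divz (D2 0 1) (D2 1 1) * D2 1 1 = modz (D2 0 1) (D2 1 1).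
      by rewrite {1}(divz_eq (D2 0 1) (D2 1 1)); ring.
    by rewrite modz_ge0 ?ltz_pmod//; lia.
have /similitude_block[_ h2 h3] := Sp4Z_equiv_similitude q3 hh.
move: h2 h3; rewrite trmx0 mul0mx subr0.
move: q3; rewrite [D3]mx22_eta D3e [A3]mx22_eta [B3]mx22_eta.
move: (A3 0 0) (A3 0 1) (A3 1 0) (A3 1 1) (B3 0 0) (B3 0 1) (B3 1 0) (B3 1 1).
move: (D3 0 0) (D3 0 1) (D3 1 1) d3 d3' b3.
move=> [a|//] [b|//] [d|//] a0 d0 /andP[_ bd] a1 a2 a3 a4 b1 b2 b3 b4 q3.
rewrite !tr_mx22 !mul_mx22 scalar_mx22 => E1 E2.
have [h1 h2 h3 h4] := mx22_inj E1; have [_ k2 _ _] := mx22_inj E2.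
have az : a%:Z != 0 by lia.
have dz : d%:Z != 0 by lia.
have nz : n%:Z != 0 by lia.
have {}h1 : a1 * a%:Z = n%:Z by rewrite -[RHS]natz -h1; ring.
have {}h3 : a2 = 0 by apply: (mulIf az); rewrite mul0r -h3; ring.
subst a2.
have {}h4 : a4 * d%:Z = n%:Z by rewrite -[RHS]natz -h4; ring.
have {}h2 : a3 * d%:Z = - (a1 * b%:Z) by apply/eqP; rewrite -addr_eq0 -h2; apply/eqP; ring.
(* Q = B A^T satisfies Q D = n B. *)
pose x := b1 * a1; pose y := b3 * a1; pose z := b3 * a3 + b4 * a4.
have f1 : x * a%:Z = b1 * n%:Z by rewrite -h1 /x; ring.
have f3 : y * a%:Z = b3 * n%:Z by rewrite -h1 /y; ring.
have f2 : x * b%:Z + y * d%:Z = b2 * n%:Z.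
  rewrite -h1 /x /y (_ : b2 * (a1 * a) = a1 * (a%:Z * b2)); last by ring.
  by rewrite -[a%:Z * b2]addr0 -[0 in RHS](mul0r b4) -k2; ring.
have f4 : y * b%:Z + z * d%:Z = b4 * n%:Z.
  rewrite -h4 /y /z (_ : _ + _ = b4 * (a4 * d) + b3 * (a1 * b%:Z + a3 * d%:Z)); last by ring.
  by rewrite h2 subrr mulr0 addr0.
(* Adding n times [s i] replaces i by its residue; these are the entries of the shear. *)
pose s i := - (i %/ n%:Z)%Z.
have sE i : i + n%:Z * s i = `|(i %% n%:Z)%Z|%N%:Z.
  rewrite gez0_abs ?modz_ge0// {1}(divz_eq i n) /s; ring.
have sn i : (`|(i %% n%:Z)%Z| < n)%N.
  by rewrite -ltz_nat gez0_abs ?modz_ge0// ltz_pmod.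
have Sh := Sp4Z_shear (tr_mx22 (s x) (s y) (s y) (s z)).
have := Sp4Z_equiv_trans q3 (ex_intro2 _ _ _ Sh erefl).
rewrite mulmx_block !mul1mx !mul0mx !mulmx0 !addr0 !add0r mul_mx22 add_mx22 !mulr0 !addr0.
set c1 := b1 + _; set c2 := b2 + _; set c3 := b3 + _; set c4 := b4 + _ => q4.
move: (sE x) (sE y) (sE z) (sn x) (sn y) (sn z).
move: `|(x %% n%:Z)%Z|%N `|(y %% n%:Z)%Z|%N `|(z %% n%:Z)%Z|%N.
move=> x' y' z' x'E y'E z'E x'n y'n z'n.
have g1 : c1 * n%:Z = (x' * a)%N%:Z by rewrite PoszM -x'E [in RHS]mulrDl f1 /c1; ring.
have g2 : c2 * n%:Z = (x' * b + y' * d)%N%:Z.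
  by rewrite PoszD !PoszM -x'E -y'E /c2 mulrDl -f2; ring.
have g3 : c3 * n%:Z = (y' * a)%N%:Z by rewrite PoszM -y'E [in RHS]mulrDl f3 /c3; ring.
have g4 : c4 * n%:Z = (y' * b + z' * d)%N%:Z.
  by rewrite PoszD !PoszM -y'E -z'E /c4 mulrDl -f4; ring.
have a3E : - a3 * (a * d)%N%:Z = (n * b)%N%:Z.
  by rewrite !PoszM -h1 mulNr mulrCA h2; ring.
have ad0 : (0 < a * d)%N by rewrite muln_gt0; lia.
have [u1 v1] := exact_divn n0 g1; have [u2 v2] := exact_divn n0 g2.
have [u3 v3] := exact_divn n0 g3; have [u4 v4] := exact_divn n0 g4.
have [w1 t1] := exact_divn (a0 : (0 < a)%N) h1; have [w4 t4] := exact_divn (d0 : (0 < d)%N) h4.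
have [w3 t3] := exact_divn ad0 a3E.
exists a, b, d, x', y', z'; split.
- by apply/and4P; split.
- by apply/and5P; split=> //; apply/and3P; split.
- by rewrite /hecke_rep -v1 -v2 -v3 -v4 -t1 -t4 -t3 opprK.
Qed.

(** The element relating two representatives is block triangular since A is invertible. Uniqueness
    of the Hermite form makes its diagonal blocks the identity; what remains is a shear, which must
    be zero because both Q have entries in [0, n). *)
Lemma hecke_rep_inj n a b d x y z a' b' d' x' y' z' : (0 < n)%N ->
  good_denom n a b d -> good_shift n a b d x y z ->
  good_denom n a' b' d' -> good_shift n a' b' d' x' y' z' ->
  Sp4Z_equiv (hecke_rep n a b d x y z) (hecke_rep n a' b' d' x' y' z') ->
  [/\ a' = a, b' = b & d' = d] /\ [/\ x' = x, y' = y & z' = z].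
Proof.
move=> n0 gD gS gD' gS' [g].
have [e1 e2 e3] := good_denomE n0 gD; have [f1 f2 f3 f4] := good_shiftE gS.
have [e1' e2' e3'] := good_denomE n0 gD'; have [f1' f2' f3' f4'] := good_shiftE gS'.
have [a0 d0] := good_denom_gt0 n0 gD; have [a0' d0'] := good_denom_gt0 n0 gD'.
have [_ _ _ bd] := and4P gD; have [_ _ _ bd'] := and4P gD'.
rewrite /hecke_rep; rewrite -(submxK g).
rewrite [ulsubmx g]mx22_eta [ursubmx g]mx22_eta [dlsubmx g]mx22_eta [drsubmx g]mx22_eta.
set A := (n %/ a)%N%:Z in e1 e2 e3 *; set D := (n %/ d)%N%:Z in e1 e2 e3 *.
set E := (n * b %/ (a * d))%N%:Z in e1 e2 e3 *.
set B1 := (x * a %/ n)%N%:Z in f1 *; set B2 := (_ %/ n)%N%:Z in f2 *.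
set B3 := (y * a %/ n)%N%:Z in f3 *; set B4 := (_ %/ n)%N%:Z in f4 *.
set B1' := (x' * a' %/ n)%N%:Z in f1' *; set B2' := (_ %/ n)%N%:Z in f2' *.
set B3' := (y' * a' %/ n)%N%:Z in f3' *; set B4' := (_ %/ n)%N%:Z in f4' *.
move: (dlsubmx g 0 0) (dlsubmx g 0 1) (dlsubmx g 1 0) (dlsubmx g 1 1) => r1 r2 r3 r4.
move: (drsubmx g 0 0) (drsubmx g 0 1) (drsubmx g 1 0) (drsubmx g 1 1) => s1 s2 s3 s4.
move: (ulsubmx g 0 0) (ulsubmx g 0 1) (ulsubmx g 1 0) (ulsubmx g 1 1) => p1 p2 p3 p4.
move: (ursubmx g 0 0) (ursubmx g 0 1) (ursubmx g 1 0) (ursubmx g 1 1) => q1 q2 q3 q4.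
move=> hg; rewrite mulmx_block !mulmx0 !addr0 !mul_mx22 !add_mx22 => /eq_block_mx.
case=> _ I K J; have [i1 i2 i3 i4] := mx22_inj I; have [j1 j2 j3 j4] := mx22_inj J.
rewrite mx22_0 in K; have [k1 k2 k3 k4] := mx22_inj K.
have ap : 0 < a%:Z by rewrite ltz_nat.
have dp : 0 < d%:Z by rewrite ltz_nat.
have az := lt0r_neq0 ap; have dz := lt0r_neq0 dp.
have nz : n%:Z != 0 by rewrite eqz_nat -lt0n.
have Dz : D != 0 by apply: contraNneq nz => D0; rewrite -e2 D0 mul0r.
have Az : A != 0 by apply: contraNneq nz => A0; rewrite -e1 A0 mul0r.
have r20 : r2 = 0 by apply: (mulIf Dz); rewrite mul0r k2; ring.
have r40 : r4 = 0 by apply: (mulIf Dz); rewrite mul0r k4; ring.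
have r10 : r1 = 0 by apply: (mulIf Az); rewrite mul0r k1 r20; ring.
have r30 : r3 = 0 by apply: (mulIf Az); rewrite mul0r k3 r40; ring.
rewrite r10 r20 r30 r40 in hg j1 j2 j3 j4.
have s30 : s3 = 0 by apply: (mulIf az); rewrite mul0r j3; ring.
have {}j1 : a'%:Z = s1 * a%:Z by rewrite j1; ring.
have {}j4 : d'%:Z = s4 * d%:Z by rewrite j4 s30; ring.
have {}j2 : b'%:Z = s1 * b%:Z + s2 * d%:Z by rewrite j2; ring.
move/similitude_block: hg => [_ + _]; rewrite !tr_mx22 !mul_mx22 opp_mx22 add_mx22 scalar_mx22.
rewrite s30 => L; have [l1 l2 l3 l4] := mx22_inj L.
have {}l1 : p1 * s1 = 1 by rewrite -[RHS]l1; ring.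
have l3' : p2 * s1 = 0 by rewrite -[RHS]l3; ring.
have s1p : 0 < s1 by rewrite -(pmulr_lgt0 _ ap) -j1 ltz_nat.
have s4p : 0 < s4 by rewrite -(pmulr_lgt0 _ dp) -j4 ltz_nat.
have p20 : p2 = 0 by apply/eqP; move/eqP: l3'; rewrite mulf_eq0 (gt_eqF s1p) orbF.
have {}l4 : p4 * s4 = 1 by rewrite -[RHS]l4 p20; ring.
have [s11 p11] := int_unit1 l1 s1p; have [s41 p41] := int_unit1 l4 s4p.
subst s1 s4 p1 p4 p2 s3.
have aE : a' = a by move: j1; rewrite mul1r => -[].
have dE : d' = d by move: j4; rewrite mul1r => -[].
subst a' d'.
have [bE s20] : b' = b /\ s2 = 0.
  by apply: (range_eq bd' bd); rewrite j2; ring.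
subst b' s2.
have p30 : p3 = 0 by rewrite -[RHS]l2; ring.
subst p3.
have [_ _ _ _] := and5P gS; have [xn yn zn _ _] := and5P gS; have [xn' yn' zn' _ _] := and5P gS'.
move: i1 i2 i3 i4; rewrite !(mul1r, mul0r, mulr0, addr0, add0r) => i1 i2 i3 i4.
have [xE q10] : x' = x /\ q1 = 0.
  apply: (range_eq xn' xn); apply: (mulIf az).
  by rewrite -f1' i1 mulrDl mulrDl f1; ring.
have [yE q30] : y' = y /\ q3 = 0.
  apply: (range_eq yn' yn); apply: (mulIf az).
  by rewrite -f3' i3 mulrDl mulrDl f3; ring.
have [zE q40] : z' = z /\ q4 = 0.
  apply: (range_eq zn' zn); apply: (mulIf dz).
  have := f4'; rewrite i4 q30 yE mul0r add0r mulrDl f4 => e.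
  by apply: (addrI (y%:Z * b%:Z)); rewrite -e; ring.
by [].
Qed.

End HeckeReps.

(** * The action on the upper half space *)

#[local] Existing Instance totally_filter.

Section SiegelAction.
Variable R : realType.
Local Notation C := R[i].
Local Notation intC := (map_mx (intr : int -> C)).
Implicit Types (g h M : 'M[int]_(2 + 2)) (Z : 'M[C]_2).

(** For v = x + i y the real part of the Hermitian form is the sum of the values of Y at x and at y,
    both nonnegative. *)
Lemma hermitian_posdef (Y : 'M[R]_2) (v : 'rV[C]_2) : posdef_mx Y ->
  (map_mx conjc v *m map_mx (real_complex R) Y *m v^T) 0 0 = 0 -> v = 0.
Proof.
move=> [Ys Yp] h; pose x : 'rV[R]_2 := map_mx (@complex.Re R) v.
pose y : 'rV[R]_2 := map_mx (@complex.Im R) v.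
have Y10 : Y 1 0 = Y 0 1 by rewrite -[in LHS]Ys mxE.
have e : (x *m Y *m x^T) 0 0 + (y *m Y *m y^T) 0 0 = 0.
  move/(congr1 (@complex.Re R)): h; rewrite !mxE !sum2E !mxE !sum2E !mxE Y10.
  by case: (v 0 0) (v 0 1) => a b [c d] /= <-; ring.
have ge0 (w : 'rV[R]_2) : 0 <= (w *m Y *m w^T) 0 0.
  by have [->|w0] := eqVneq w 0; [rewrite !mul0mx mxE | exact: ltW (Yp _ w0)].
have x0 : x = 0.
  apply/eqP; apply: contraT => nx; have hx := Yp _ nx; move/eqP: e.
  by rewrite gt_eqF// ltr_pwDl.
have y0 : y = 0.
  apply/eqP; apply: contraT => ny; have hy := Yp _ ny; move/eqP: e.
  by rewrite gt_eqF// ltr_wpDl.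
apply/rowP => j; move/rowP: x0 => /(_ j); move/rowP: y0 => /(_ j); rewrite !mxE.
by case: (v 0 j) => a b /= -> ->.
Qed.

Lemma siegel_denom_block (A B D E : 'M[int]_2) Z :
  siegel_denom (block_mx A B D E) Z = intC D *m Z + intC E.
Proof. by rewrite /siegel_denom block_mxKdl block_mxKdr. Qed.

Lemma siegel_act_block (A B D E : 'M[int]_2) Z :
  siegel_act (block_mx A B D E) Z =
  (intC A *m Z + intC B) *m invmx (siegel_denom (block_mx A B D E) Z).
Proof. by rewrite /siegel_act block_mxKul block_mxKur. Qed.

Lemma conj_intC (A : 'M[int]_2) : map_mx conjc (intC A) = intC A.
Proof. by apply/matrixP => i j; rewrite !mxE rmorph_int. Qed.

(* If (C Z + D) w = 0 then, by the symplectic relations, the Hermitian form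
   of (Z - conj Z) / 2i vanishes at w, whereas it is positive definite. *)
Lemma siegel_denom_unit (mu : nat) M Z : (0 < mu)%N -> similitude mu M ->
  siegel_upper_half Z -> siegel_denom M Z \in unitmx.
Proof.
move=> mu0 hM [Zs Yp]; rewrite -unitmx_tr unitmxE unitfE; apply/negP => /det0P[v v0].
move: hM; rewrite -(submxK M) siegel_denom_block.
move: (ulsubmx M) (ursubmx M) (dlsubmx M) (drsubmx M) => A B D E /similitude_block[h1 h2 h3] vQ.
case/negP: v0; apply/eqP; apply: (hermitian_posdef Yp).
pose Zc := map_mx conjc Z; pose w := v^T; pose wc := map_mx conjc v.
have Qw : (intC D *m Z + intC E) *m w = 0.
  by apply: trmx_inj; rewrite trmx_mul trmxK vQ trmx0.
have Zcs : Zc^T = Zc by rewrite /Zc map_trmx Zs.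
have wQ : wc *m (Zc *m (intC D)^T + (intC E)^T) = 0.
  move/(congr1 (map_mx conjc)): vQ; rewrite map_mxM -map_trmx.
  rewrite map_mxD map_mxM !conj_intC linearD /= trmx_mul -/Zc Zcs => ->.
  by apply/matrixP => i j; rewrite !mxE rmorph0.
have key : mu%:R *: (wc *m (Zc - Z) *m w) = 0 :> 'M[C]_1.
  have e1 : (intC A)^T *m intC D = (intC D)^T *m intC A.
    by rewrite !map_trmx -!map_mxM h1.
  have e3 : (intC B)^T *m intC E = (intC E)^T *m intC B.
    by rewrite !map_trmx -!map_mxM h3.
  have e2 : (intC A)^T *m intC E = mu%:R%:M + (intC D)^T *m intC B.
    rewrite !map_trmx -!map_mxM -[mu%:R](rmorph_nat (intr : int -> C)) -map_scalar_mx -h2.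
    by rewrite map_mxB subrK.
  have e4 : (intC B)^T *m intC D = (intC E)^T *m intC A - mu%:R%:M.
    move/(congr1 trmx): e2; rewrite linearD /= !trmx_mul !trmxK tr_scalar_mx => ->.
    by rewrite addrC addKr.
  have aux (X Q P Y : 'M[C]_2) : Q *m w = 0 -> wc *m Y = 0 ->
      wc *m (X *m Q - Y *m P) *m w = 0.
    move=> q0 y0; rewrite mulmxBr mulmxBl !mulmxA -[_ *m Q *m w]mulmxA q0.
    by rewrite y0 mulmx0 !mul0mx subrr.
  rewrite -[RHS](aux (Zc *m (intC A)^T + (intC B)^T) _ (intC A *m Z + intC B) _ Qw wQ).
  rewrite scalemxAl scalemxAr; congr (_ *m _ *m _).
  rewrite !mulmxDl !mulmxDr -!(mulmxA Zc) !(mulmxA _ _ Z) e1 e2 e3 e4.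
  rewrite mulmxDr mulmxBl mul_mx_scalar mul_scalar_mx scalerBr.
  by apply/matrixP => i j; rewrite !mxE; ring.
have {key} : wc *m (Zc - Z) *m w = 0.
  by move/eqP: key; rewrite scaler_eq0 pnatr_eq0 gtn_eqF//= => /eqP.
have -> : Zc - Z = - (2 * 'i%C) *: map_mx (real_complex R) (map_mx (@complex.Im R) Z).
  apply/matrixP => i j; rewrite !mxE -opprB subcJ.
  by rewrite -[2%:R]/(2 : C); ring.
rewrite -scalemxAr -scalemxAl => /eqP; rewrite scaler_eq0 oppr_eq0 mulf_eq0 pnatr_eq0 /=.
by rewrite eq_complex /= oner_eq0 andbF /= => /eqP ->; rewrite mxE.
Qed.

Lemma siegel_denomM g h Z : siegel_denom h Z \in unitmx ->
  siegel_denom (g *m h) Z = siegel_denom g (siegel_act h Z) *m siegel_denom h Z.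
Proof.
rewrite -(submxK g) -(submxK h) mulmx_block !siegel_denom_block siegel_act_block => u.
move: u; rewrite siegel_denom_block => u; rewrite mulmxDl -mulmxA mulmxKV//.
by rewrite !map_mxD !map_mxM !mulmxDl !mulmxDr !mulmxA addrACA.
Qed.

Lemma siegel_actM g h Z : siegel_denom h Z \in unitmx ->
  siegel_denom g (siegel_act h Z) \in unitmx ->
  siegel_act (g *m h) Z = siegel_act g (siegel_act h Z).
Proof.
move=> uh ug; have := siegel_denomM g uh; move: uh ug.
rewrite -(submxK g) -(submxK h).
move: (ulsubmx g) (ursubmx g) (dlsubmx g) (drsubmx g) => A B D E.
move: (ulsubmx h) (ursubmx h) (dlsubmx h) (drsubmx h) => A' B' D' E'.
set h' := block_mx A' _ _ _; set g' := block_mx A _ _ _ => uh ug e.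
have -> : siegel_act (g' *m h') Z =
   (intC (A *m A' + B *m D') *m Z + intC (A *m B' + B *m E')) *m
   invmx (siegel_denom (g' *m h') Z).
  by rewrite [g' *m h']mulmx_block siegel_act_block.
rewrite e {2}/siegel_act /g' block_mxKul block_mxKur -/g'.
apply: (canRL (mulmxK ug)); apply: (can_inj (mulmxK uh)).
have hW : siegel_act h' Z *m siegel_denom h' Z = intC A' *m Z + intC B'.
  by rewrite /siegel_act /h' block_mxKul block_mxKur -/h' mulmxKV.
rewrite -[LHS]mulmxA mulmxKV ?unitmx_mul ?ug// [RHS]mulmxDl -[_ *m _ *m siegel_denom h' Z]mulmxA hW.
rewrite siegel_denom_block !map_mxD !map_mxM !mulmxDl !mulmxDr !mulmxA.
by rewrite addrACA.
Qed.

(** This makes the element chosen in a coset immaterial. Membership of h Z in the upper half space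
    is later supplied for the triangular representatives, where the action is explicit. *)
Lemma slash_Sp4Z (k : int) (n : nat) (F : 'M[C]_2 -> C) g h Z : (0 < n)%N ->
  siegel_modular_form k F -> Sp4Z g -> similitude n h -> siegel_upper_half Z ->
  siegel_upper_half (siegel_act h Z) -> slash k (g *m h) F Z = slash k h F Z.
Proof.
move=> n0 [_ Fmod] hg hh HZ HhZ.
have uh := siegel_denom_unit n0 hh HZ.
have ug := siegel_denom_unit (isT : (0 < 1)%N) hg HhZ.
rewrite /slash siegel_denomM// siegel_actM// Fmod// det_mulmx expfzMl.
have dg : \det (siegel_denom g (siegel_act h Z)) != 0 by rewrite -unitfE -unitmxE.
have aux (x y f : C) : x != 0 -> x ^ (- k) * y * (x ^ k * f) = y * f.
  by move=> x0; rewrite mulrACA -expfzDr// addNr expr0z mul1r.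
exact: aux.
Qed.

End SiegelAction.

#[local] Existing Instance totally_filter.

(** * The action of the reduced representatives on expansions *)

Section HeckeSum.
Variable R : realType.
Local Notation C := R[i].
Local Notation toC := (map_mx (ratr : rat -> C)).
Implicit Types (g h M : 'M[int]_(2 + 2)) (Z : 'M[C]_2).

Lemma siegel_upper_halfZ (s : rat) Z : 0 < s -> siegel_upper_half Z ->
  siegel_upper_half (ratr s *: Z).
Proof.
move=> s0 [Zs [Ys Yp]]; split; first by rewrite linearZ /= Zs.
have sR : 0 < (ratr s : R) by rewrite ltr0q.
have -> : map_mx (@complex.Im R) (ratr s *: Z) = (ratr s : R) *: map_mx (@complex.Im R) Z.
  by apply/matrixP => i j; rewrite !mxE mulrC Im_mul_ratr mulrC.
split=> [|v v0]; first by rewrite linearZ /= Ys.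
by rewrite -scalemxAr -scalemxAl mxE mulr_gt0// Yp.
Qed.

Lemma expands_scale (f : 'M[C]_2 -> C) c (s : rat) : 0 < s -> expands f c ->
  expands (fun Z => f (ratr s *: Z)) (fun N => c (s^-1 *: N)).
Proof.
move=> s0 hf Z HZ; have sz := lt0r_neq0 s0.
have K1 : cancel ( *:%R s^-1 : 'M[rat]_2 -> 'M[rat]_2) ( *:%R s).
  by move=> N; rewrite scalerA divff// scale1r.
have K2 : cancel ( *:%R s : 'M[rat]_2 -> 'M[rat]_2) ( *:%R s^-1).
  by move=> N; rewrite scalerA mulVf// scale1r.
have := sums_to_reindex K1 K2 (hf _ (siegel_upper_halfZ s0 HZ)).
congr (sums_to _ _); apply: funext => N; rewrite /=; congr (_ * _).
rewrite /qexp; congr (cexp (_ * \tr _)).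
by rewrite -scalemxAr scalemxAl -map_mxZ scalerA divff// scale1r.
Qed.

Definition denom_mx (a b d : nat) : 'M[rat]_2 := mx22 a%:R b%:R 0 d%:R.
Definition shift_mx (n x y z : nat) : 'M[rat]_2 :=
  n%:R^-1 *: mx22 x%:R y%:R y%:R z%:R.

Lemma tr_shift_mx n x y z : (shift_mx n x y z)^T = shift_mx n x y z.
Proof. by rewrite linearZ /= tr_mx22. Qed.

Lemma denom_mx_unit a b d : (0 < a)%N -> (0 < d)%N -> denom_mx a b d \in unitmx.
Proof.
by move=> a0 d0; rewrite unitmxE det_mx22 mulr0 subr0 unitfE mulf_neq0// pnatr_eq0 -lt0n.
Qed.

Lemma siegel_denom_rep n a b d x y z Z :
  siegel_denom (hecke_rep n a b d x y z) Z = toC (denom_mx a b d).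
Proof.
rewrite siegel_denom_block map_mx0 mul0mx add0r !map_mx22.
by rewrite -!pmulrn !ratr_nat !rmorph0.
Qed.

(** The representative acts by the affine map taking Z to n D^-T Z D^-1 + Q / n, which is within
    reach of [expands_scale] and [expands_transform]. *)
Lemma siegel_act_rep n a b d x y z Z : (0 < n)%N ->
  good_denom n a b d -> good_shift n a b d x y z ->
  siegel_act (hecke_rep n a b d x y z) Z =
  (toC (invmx (denom_mx a b d)))^T *m (ratr n%:R *: Z) *m toC (invmx (denom_mx a b d))
   + toC (shift_mx n x y z).
Proof.
move=> n0 gD gS; have [a0 d0] := good_denom_gt0 n0 gD.
have [e1 e2 e3] := good_denomE n0 gD; have [f1 f2 f3 f4] := good_shiftE gS.
have Du := denom_mx_unit b a0 d0.
have DuC : toC (denom_mx a b d) \in unitmx by rewrite map_unitmx.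
apply: (can_inj (mulmxK DuC)).
rewrite siegel_act_block siegel_denom_rep mulmxKV// mulmxDl -scalemxAr -!scalemxAl -!mulmxA.
rewrite -[toC (invmx _) *m _]map_mxM mulVmx// map_mx1 mulmx1.
have nz : n%:R != 0 :> rat by rewrite pnatr_eq0 -lt0n.
have cast (u v : int) : u = v -> u%:~R = v%:~R :> rat by move=> ->.
congr (_ + _).
  rewrite map_trmx scalemxAl -map_mxZ; congr (_ *m _).
  have -> : n%:R *: (invmx (denom_mx a b d))^T = (n%:R *: invmx (denom_mx a b d))^T.
    by rewrite linearZ.
  have -> : n%:R *: invmx (denom_mx a b d) =
     mx22 (n %/ a)%N%:R (- (n * b %/ (a * d))%N%:R) 0 (n %/ d)%N%:R.
    apply: (can_inj (mulmxK Du)); rewrite -scalemxAl mulVmx// mul_mx22.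
    have e1' := cast _ _ e1; have e2' := cast _ _ e2; have e3' := cast _ _ e3.
    rewrite !intrM in e1' e2' e3'.
    rewrite scale_scalar_mx scalar_mx22; congr mx22; rewrite ?mulr0 ?mul0r ?addr0 ?add0r ?mulr1//.
    by rewrite mulNr; apply/eqP; rewrite eq_sym subr_eq0 eq_sym; apply/eqP.
  rewrite tr_mx22 !map_mx22 !rmorphN /= !ratr_nat rmorph0.
  by rewrite -?pmulrn ?rmorph0; congr mx22.
have -> : toC (shift_mx n x y z) *m toC (denom_mx a b d) =
  toC (shift_mx n x y z *m denom_mx a b d) by rewrite map_mxM.
rewrite /shift_mx -scalemxAl mul_mx22 scale_mx22 !map_mx22.
have g1 := cast _ _ f1; have g2 := cast _ _ f2; have g3 := cast _ _ f3; have g4 := cast _ _ f4.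
rewrite ?intrD !intrM in g1 g2 g3 g4.
have fin (u : rat) (v : nat) : v%:~R * n%:~R = u -> (v%:Z%:~R : C) = ratr (n%:R^-1 * u).
  by move=> <-; rewrite mulrCA mulVf// mulr1 ratr_nat.
by congr mx22; apply: fin; rewrite ?mulr0 ?addr0.
Qed.

End HeckeSum.

(** * Hecke operators on Fourier coefficients *)

#[local] Existing Instance totally_filter.

Section DoubleCosets.
Implicit Types (g h M : 'M[int]_(2 + 2)).

(** A box containing all reduced parameters: a and d divide n and b < d, whence the bound n + 1,
    while x, y, z are residues. *)
Definition hecke_index (n : nat) : finType :=
  ('I_n.+1 * 'I_n.+1 * 'I_n.+1 * ('I_n * 'I_n * 'I_n))%type.

Definition good_index n (i : hecke_index n) : bool :=
  good_denom n i.1.1.1 i.1.1.2 i.1.2 &&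
  good_shift n i.1.1.1 i.1.1.2 i.1.2 i.2.1.1 i.2.1.2 i.2.2.

Definition index_rep n (i : hecke_index n) : 'M[int]_(2 + 2) :=
  hecke_rep n i.1.1.1 i.1.1.2 i.1.2 i.2.1.1 i.2.1.2 i.2.2.

Lemma index_rep_similitude n (i : hecke_index n) : (0 < n)%N -> good_index i ->
  similitude n (index_rep i).
Proof. by move=> n0 /andP[]; exact: hecke_rep_similitude. Qed.

Lemma index_rep_exists n h : (0 < n)%N -> similitude n h ->
  exists2 i : hecke_index n, good_index i & Sp4Z_coset (index_rep i) = Sp4Z_coset h.
Proof.
move=> n0 /(hecke_rep_exists n0)[a [b [d [x [y [z [gD gS]]]]]]] /Sp4Z_equiv_coset e.
have [an dn _ bd] := and4P gD; have [xn yn zn _ _] := and5P gS.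
have an' : (a < n.+1)%N by rewrite ltnS dvdn_leq.
have dn' : (d < n.+1)%N by rewrite ltnS dvdn_leq.
have bn' : (b < n.+1)%N by exact: ltn_trans bd dn'.
by exists (Ordinal an', Ordinal bn', Ordinal dn', (Ordinal xn, Ordinal yn, Ordinal zn));
  rewrite /good_index /= ?gD.
Qed.

Lemma index_rep_inj n (i j : hecke_index n) : (0 < n)%N ->
  good_index i -> good_index j ->
  Sp4Z_coset (index_rep i) = Sp4Z_coset (index_rep j) -> i = j.
Proof.
move=> n0 /andP[gi gi'] /andP[gj gj'] e.
have [g hg eg] : Sp4Z_coset (index_rep i) (index_rep j).
  by rewrite e; exact: Sp4Z_coset_refl.
have := hecke_rep_inj n0 gi gi' gj gj' (ex_intro2 _ _ g hg (esym eg)).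
move: i j {e eg gi gi' gj gj'} => [[[a b] d] [[x y] z]] [[[a' b'] d'] [[x' y'] z']] /=.
by case=> [[/val_inj-> /val_inj-> /val_inj->] [/val_inj-> /val_inj-> /val_inj->]].
Qed.

Lemma double_coset_refl g : double_coset g g.
Proof. by exists 1%:M, 1%:M; rewrite mul1mx mulmx1; split=> //; exact: Sp4Z1. Qed.

Lemma double_coset_sym g h : double_coset g h -> double_coset h g.
Proof.
move=> [x [y [hx hy ->]]].
have [x' [hx' xx' _]] := Sp4Z_inv hx; have [y' [hy' _ yy']] := Sp4Z_inv hy.
exists x', y'; split=> //.
by rewrite !mulmxA xx' mul1mx -mulmxA yy' mulmx1.
Qed.

Lemma double_coset_trans g h h' :
  double_coset g h -> double_coset h h' -> double_coset g h'.
Proof.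
move=> [x [y [hx hy ->]]] [x' [y' [hx' hy' ->]]].
exists (x' *m x), (y *m y'); split; [exact: Sp4ZM|exact: Sp4ZM|].
by rewrite !mulmxA.
Qed.

Lemma double_cosetMl g h x : Sp4Z x -> double_coset g h -> double_coset g (x *m h).
Proof.
move=> hx gh; apply: double_coset_trans gh _.
by exists x, 1%:M; rewrite mulmx1; split=> //; exact: Sp4Z1.
Qed.

Lemma double_coset_similitude n g h : similitude n g -> double_coset g h -> similitude n h.
Proof.
move=> hg [x [y [hx hy ->]]]; rewrite -[n]muln1; apply: similitudeM hy.
by rewrite -[n]mul1n; exact: similitudeM.
Qed.

End DoubleCosets.

Section HeckeSum.
Variable R : realType.
Local Notation C := R[i].
Local Notation toC := (map_mx (ratr : rat -> C)).
Implicit Types (g h M : 'M[int]_(2 + 2)) (Z : 'M[C]_2).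

Lemma siegel_upper_half_rep n (i : hecke_index n) Z : (0 < n)%N -> good_index i ->
  siegel_upper_half Z -> siegel_upper_half (siegel_act (index_rep i) Z).
Proof.
move=> n0 /andP[gD gS] HZ; rewrite siegel_act_rep//.
have [a0 d0] := good_denom_gt0 n0 gD.
apply: siegel_upper_half_transform; last by apply: siegel_upper_halfZ; rewrite ?ltr0n.
- by rewrite unitmx_inv denom_mx_unit.
- exact: tr_shift_mx.
Qed.

(** The index whose exponential becomes the one at N after the substitution of n D^-T Z D^-1 for
    Z. *)
Definition index_mx n (i : hecke_index n) (N : 'M[rat]_2) : 'M[rat]_2 :=
  n%:R^-1 *: (denom_mx i.1.1.1 i.1.1.2 i.1.2 *m N *m (denom_mx i.1.1.1 i.1.1.2 i.1.2)^T).

Lemma expands_index n (i : hecke_index n) (F : 'M[C]_2 -> C) c : (0 < n)%N ->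
  good_index i -> expands F c ->
  expands (fun Z => F (siegel_act (index_rep i) Z))
    (fun N => c (index_mx i N) *
       uexp R (\tr (index_mx i N *m shift_mx n i.2.1.1 i.2.1.2 i.2.2))).
Proof.
move=> n0 /andP[gD gS] hF; have [a0 d0] := good_denom_gt0 n0 gD.
have Du := denom_mx_unit i.1.1.2 a0 d0.
have n0' : 0 < n%:R :> rat by rewrite ltr0n.
have iDu : invmx (denom_mx i.1.1.1 i.1.1.2 i.1.2) \in unitmx by rewrite unitmx_inv.
have := expands_scale n0' (expands_transform iDu (tr_shift_mx n i.2.1.1 i.2.1.2 i.2.2) hF).
congr (expands _ _); first by apply: funext => Z; rewrite siegel_act_rep.
by apply: funext => N; rewrite invmxK /index_mx -scalemxAr -scalemxAl.
Qed.

(** Sending j to [Sp4Z_coset (index_rep j)] is a bijection from the good indices in the double coset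
    to the cosets summed over in [hecke_op]. *)
Lemma hecke_op_index k n (F : 'M[C]_2 -> C) (i : hecke_index n) Z : (0 < n)%N ->
  siegel_modular_form k F -> good_index i -> siegel_upper_half Z ->
  hecke_op k n (index_rep i) F Z = n%:R ^ (2 * k - 3) *
   \sum_(j : hecke_index n | good_index j && `[< double_coset (index_rep i) (index_rep j) >])
      slash k (index_rep j) F Z.
Proof.
move=> n0 hF gi HZ; rewrite /hecke_op; congr (_ * _).
pose p := [pred j : hecke_index n |
  good_index j && `[< double_coset (index_rep i) (index_rep j) >]].
rewrite (_ : \sum_(j | _) _ = \sum_(j <- enum p) slash k (index_rep j) F Z);
  last by rewrite big_enum.
rewrite (@reindex_fsbig _ _ _ _ _ (fun j => Sp4Z_coset (index_rep j)) [set` enum p]).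
  rewrite -fsbig_seq ?enum_uniq//; apply: eq_big_seq => j; rewrite mem_enum => /andP[gj _].
  have [|g hg <-] := @xgetPex _ 0 (Sp4Z_coset (index_rep j)).
    by exists (index_rep j); exact: Sp4Z_coset_refl.
  by rewrite (slash_Sp4Z n0 hF hg (index_rep_similitude n0 gj) HZ (siegel_upper_half_rep n0 gj HZ)).
split.
- move=> j /=; rewrite mem_enum => /andP[_ /asboolP dj].
  by exists (index_rep j).
- move=> j j' /set_mem /= + /set_mem /=; rewrite !mem_enum => /andP[gj _] /andP[gj' _].
  exact: index_rep_inj.
- move=> _ [h dh <-].
  have hh := double_coset_similitude (index_rep_similitude n0 gi) dh.
  have [j gj ej] := index_rep_exists n0 hh; exists j => //=.
  rewrite mem_enum; apply/andP; split=> //; apply/asboolP.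
  have [x hx <-] : Sp4Z_coset h (index_rep j) by rewrite -ej; exact: Sp4Z_coset_refl.
  exact: double_cosetMl.
Qed.

(* The sum over all cosets of multiplier n splits according to double cosets. *)
Lemma hecke_eigen_sum k n (F : 'M[C]_2 -> C) : (0 < n)%N -> hecke_eigenform k F ->
  exists L : C, forall Z, siegel_upper_half Z ->
    n%:R ^ (2 * k - 3) *
    \sum_(j : hecke_index n | good_index j) slash k (index_rep j) F Z = L * F Z.
Proof.
move=> n0 [hF _ hE].
pose dc (i j : hecke_index n) := `[< double_coset (index_rep i) (index_rep j) >].
have lamP (i : hecke_index n) : exists l : C, good_index i -> forall Z,
    siegel_upper_half Z -> hecke_op k n (index_rep i) F Z = l * F Z.
  case: (boolP (good_index i)) => gi; last by exists 0.
  by have [l hl] := hE n _ n0 (index_rep_similitude n0 gi); exists l.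
have [lam hlam] := choice lamP.
pose cl (i : hecke_index n) := [set j | good_index j && dc i j]%SET.
have clE i j : good_index i -> good_index j -> (cl j == cl i) = dc i j.
  move=> gi gj; apply/eqP/idP => [e|/asboolP ij].
    have : j \in cl j by rewrite inE gj; apply/asboolP; exact: double_coset_refl.
    by rewrite e inE => /andP[].
  apply/setP => l; rewrite !inE; congr (_ && _); apply/asboolP/asboolP.
    exact: double_coset_trans.
  by apply: double_coset_trans; exact: double_coset_sym.
pose S := [set cl i | i in [set i | good_index i]]%SET.
(* Each class contributes the eigenvalue of one of its members, so L is the sum of the eigenvalues
   over the double cosets; the default 0 is never reached on S. *)
pose rep (E : {set hecke_index n}) := [pick i | good_index i && (cl i == E)].
exists (\sum_(E in S) if rep E is Some i then lam i else 0) => Z HZ.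
rewrite mulr_sumr mulr_suml.
rewrite (eq_bigl (mem [set i | good_index i]%SET)); last by move=> i; rewrite !inE.
rewrite (partition_big_imset cl)/=; apply: eq_bigr => E /imsetP[i0]; rewrite inE => gi0 E0.
rewrite /rep; case: pickP => [i /andP[gi /eqP iE]|/(_ i0)]; last first.
  by rewrite gi0 E0 eqxx.
rewrite -(hlam i gi Z HZ) hecke_op_index// mulr_sumr.
apply: eq_bigl => j; rewrite inE; case: (boolP (good_index j)) => //= gj.
by rewrite -iE clE.
Qed.

(** Both sides are coefficients of one function. The factor n^(2k-3) is absorbed into L, and the
    powers with exponent -k come from the automorphy factor det D = a d. *)
Lemma hecke_eigen_coeff k n (F : 'M[C]_2 -> C) c : (0 < n)%N -> hecke_eigenform k F ->
  expands F c -> (forall N, N^T != N -> c N = 0) ->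
  exists L : C, forall N, L * c N =
    \sum_(j : hecke_index n | good_index j)
      (j.1.1.1 * j.1.2)%:R ^ (- k) * (c (index_mx j N) *
       uexp R (\tr (index_mx j N *m shift_mx n j.2.1.1 j.2.1.2 j.2.2))).
Proof.
move=> n0 hE hF cs; have [L hL] := hecke_eigen_sum n0 hE.
have nz : (n%:R : C) ^ (2 * k - 3) != 0 by rewrite expfz_neq0// pnatr_eq0 -lt0n.
exists ((n%:R ^ (2 * k - 3))^-1 * L) => N.
have h1 := expandsZ ((n%:R ^ (2 * k - 3))^-1 * L) hF.
have h2 := @expands_sum R _ (index_enum _) (@good_index n) _ _ (fun j gj =>
  expandsZ ((j.1.1.1 * j.1.2)%:R ^ (- k)) (expands_index n0 gj hF)).
apply: (@expands_uniq _ _ _ _ N h1 (expands_ext _ h2)) => [Z HZ|M Ms|M Ms].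
- rewrite -mulrA -(hL Z HZ) mulKf//; apply: eq_bigr => j gj.
  rewrite /slash siegel_denom_rep; congr (_ ^ _ * _).
  by rewrite map_mx22 det_mx22 !ratr_nat rmorph0 mulr0 subr0 natrM.
- by rewrite cs// mulr0.
- rewrite big1// => j gj; rewrite cs ?mul0r ?mulr0//.
  have /andP[gD _] := gj; have [a0 d0] := good_denom_gt0 n0 gD.
  have Du := denom_mx_unit j.1.1.2 a0 d0.
  apply: contra Ms => /eqP; rewrite /index_mx linearZ /= !trmx_mul trmxK.
  have n1 : n%:R^-1 != 0 :> rat by rewrite invr_eq0 pnatr_eq0 -lt0n.
  move/(scalerI n1); rewrite !mulmxA -!(mulmxA (denom_mx _ _ _)).
  move/(can_inj (mulKmx Du)) => e; apply/eqP.
  by apply: (can_inj (mulmxK (_ : (denom_mx j.1.1.1 j.1.1.2 j.1.2)^T \in unitmx))) => //;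
    rewrite unitmx_tr.
Qed.

End HeckeSum.

#[local] Existing Instance totally_filter.

(** * Unimodular invariance of the coefficients and reduction of forms *)

Section Coefficients.
Variable R : realType.
Local Notation C := R[i].
Local Notation toC := (map_mx (ratr : rat -> C)).
Local Notation toQ := (map_mx (intr : int -> rat)).

(** Modularity under diag(U, W) reads F(U Z U^T) = det(W)^k F(Z). Determinant -1 is allowed: it is
    the source of the sign (-1)^k in the recursion. *)
Lemma coeff_unimodular k (F : 'M[C]_2 -> C) c (U W : 'M[int]_2) (N : 'M[rat]_2) :
  siegel_modular_form k F -> expands F c -> (forall N, N^T != N -> c N = 0) ->
  U^T *m W = 1%:M -> c (toQ W *m N *m (toQ W)^T) = (\det W)%:~R ^ k * c N.
Proof.
move=> [_ Fmod] hF cs UW.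
have WU := mulmx1C UW.
have Gu : toQ U^T \in unitmx.
  by have [] := @mulmx1_unit _ _ (toQ U^T) (toQ W); rewrite -?map_mxM ?UW ?map_mx1.
have GV : invmx (toQ U^T) = toQ W.
  by apply: (can_inj (mulKmx Gu)); rewrite mulmxV// -map_mxM UW map_mx1.
have Wu : toQ W \in unitmx by rewrite -GV unitmx_inv.
have intE (M : 'M[int]_2) : toC (toQ M) = map_mx intr M.
  by apply/matrixP => i j; rewrite !mxE ratr_int.
have h1 := expands_transform Gu (trmx0 _ _ _) hF.
have h2 := expandsZ ((\det W)%:~R ^ k) hF.
have -> : c (toQ W *m N *m (toQ W)^T) = c (invmx (toQ U^T) *m N *m (invmx (toQ U^T))^T) *
              uexp R (\tr (invmx (toQ U^T) *m N *m (invmx (toQ U^T))^T *m 0)).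
  by rewrite mulmx0 linear0 uexp0 mulr1 GV.
apply: (@expands_uniq _ _ _ _ N (expands_ext _ h1) h2) => [Z HZ|M Ms|M Ms].
- have hg := Sp4Z_unimodular UW.
  have := Fmod _ Z hg HZ; rewrite siegel_act_block siegel_denom_block.
  rewrite !map_mx0 mul0mx add0r addr0 => FE.
  have detW : \det (map_mx intr W : 'M[C]_2) = (\det W)%:~R by rewrite det_map_mx.
  rewrite -detW -FE ?addr0; congr (F _).
  have WuC : (map_mx intr W : 'M[C]_2) \in unitmx by rewrite -intE map_unitmx.
  apply: (can_inj (mulmxK WuC)); rewrite mulmxKV// !intE.
  by rewrite -[LHS]mulmxA -map_mxM UW map_mx1 mulmx1 map_trmx trmxK.
- rewrite cs ?mul0r// GV; apply: contra Ms => /eqP; rewrite !trmx_mul trmxK mulmxA => e.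
  apply/eqP/(can_inj (mulKmx Wu)).
  by apply: (can_inj (mulmxK (_ : (toQ W)^T \in unitmx))) => //; rewrite unitmx_tr.
- by rewrite cs// mulr0.
Qed.

End Coefficients.

(* Reduction theory for the discriminant -4: some diagonal entry is at most
   |w2|, so that a shear decreases |w2|. *)
Lemma unimodular_form_sum2 (w1 w2 w3 : int) : 0 < w1 -> w1 * w3 - w2 * w2 = 1 ->
  exists p q r s : int, [/\ p * s - q * r = 1, w1 = p * p + q * q,
    w2 = p * r + q * s & w3 = r * r + s * s].
Proof.
have [m] := ubnP `|w2|%N; elim: m w1 w2 w3 => // m IH w1 w2 w3 w2m w10 e.
have w30 : 0 < w3.
  by rewrite -(pmulr_rgt0 _ w10) (_ : w1 * w3 = 1 + w2 * w2) ?ltr_wpDr// -?e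
    ?subrK// -expr2 sqr_ge0.
have [w20|w20] := eqVneq w2 0.
  have e' : w3 * w1 = 1 by rewrite -e w20; ring.
  have [w11 w31] := int_unit1 e' w10.
  by exists 1, 0, 0, 1; rewrite w11 w31 w20.
(* t is the sign of w2; the identities below hold modulo t * t = 1, which is why multiples of 1 - t
   * t appear in them. *)
have [t [t2 tw]] : exists t : int, t * t = 1 /\ `|w2|%N%:Z = t * w2.
  by case: (ltrP 0 w2) => h; [exists 1|exists (-1)]; split=> //; lia.
have tw0 : 0 < t * w2 by rewrite -tw ltz_nat absz_gt0.
have w22 : w2 * w2 = (t * w2) * (t * w2) by rewrite mulrACA t2 mul1r.
have t1 : `|t|%N = 1%N.
  by have /eqP : (`|t| * `|t|)%N = 1%N; [rewrite -abszM t2 | rewrite muln_eq1 => /andP[/eqP]].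
have decr w : 0 < w -> w <= t * w2 -> (`|(w2 - t * w)%R|%N < m)%N.
  move=> w0 le; have -> : w2 - t * w = t * (t * w2 - w) by rewrite mulrBr mulrA t2 mul1r.
  by rewrite abszM t1 mul1n; move: w2m tw le w0; move: (t * w2) => v; clear; lia.
have [le1|lt1] := lerP w1 (t * w2).
  have [|//||p [q [r [s [d e1 e2 e3]]]]] := IH w1 (w2 - t * w1) (w3 - 2 * t * w2 + w1).
  - exact: decr.
  - rewrite (_ : _ - _ = (w1 * w3 - w2 * w2) + w1 * w1 * (1 - t * t)); last by ring.
    by rewrite t2 e subrr mulr0 addr0.
  - exists p, q, (r + t * p), (s + t * q); split => //.
    + by rewrite -d; ring.
    + by rewrite -[LHS](subrK (t * w1)) e2 e1; ring.
    + have -> : w3 = (w3 - 2 * t * w2 + w1) + 2 * t * (w2 - t * w1) + w1 * (t * t + (t * t - 1)).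
        by ring.
      by rewrite e3 e2 e1 (_ : t * t + (t * t - 1) = t * t); [ring | rewrite t2].
(* If both diagonal entries exceeded v = |w2| > 0, the determinant would be at least (v + 1)^2 - v^2
   > 1. *)
have le3 : w3 <= t * w2.
  rewrite leNgt; apply/negP => lt3; move: e; rewrite w22.
  by move: (t * w2) tw0 lt1 lt3 => v; clear; nia.
have w1' : 0 < w1 - 2 * t * w2 + w3.
  rewrite -(pmulr_lgt0 _ w30).
  rewrite (_ : _ * w3 = (w1 * w3 - w2 * w2) + (w2 - t * w3) * (w2 - t * w3) +
    w3 * w3 * (1 - t * t)).
    by rewrite e t2 subrr mulr0 addr0 ltr_wpDr// -expr2 sqr_ge0.
  by ring.
have [|//||p [q [r [s [d e1 e2 e3]]]]] := IH (w1 - 2 * t * w2 + w3) (w2 - t * w3) w3.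
- exact: decr.
- rewrite (_ : _ - _ = (w1 * w3 - w2 * w2) + w3 * w3 * (1 - t * t)); last by ring.
  by rewrite t2 e subrr mulr0 addr0.
- exists (p + t * r), (q + t * s), r, s; split => //.
  + by rewrite -d; ring.
  + have -> : w1 = (w1 - 2 * t * w2 + w3) + 2 * t * (w2 - t * w3) + w3 * (t * t + (t * t - 1)).
      by ring.
    by rewrite e1 e2 e3 (_ : t * t + (t * t - 1) = t * t); [ring | rewrite t2].
  + by rewrite -[LHS](subrK (t * w3)) e2 e3; ring.
Qed.

(** * Coefficients at scalar matrices *)

#[local] Existing Instance totally_filter.

Section CharacterSums.
Variables (R : realType) (n : nat).
Hypothesis n0 : (0 < n)%N.
Local Notation C := R[i].
Local Notation idx := ('I_n * 'I_n * 'I_n)%type.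

(** This is tr(T Q / n) for the half-integral T = [[t1, t2/2], [t2/2, t3]] and Q with the entries of
    q. *)
Definition shift_phase (t1 t2 t3 : int) (q : idx) : rat :=
  (t1%:~R * (q.1.1 : nat)%:R + t2%:~R * (q.1.2 : nat)%:R + t3%:~R * (q.2 : nat)%:R) / n%:R.

Let addq (q0 q : idx) : idx :=
  (Ordinal (ltn_pmod (q.1.1 + q0.1.1)%N n0), Ordinal (ltn_pmod (q.1.2 + q0.1.2)%N n0),
   Ordinal (ltn_pmod (q.2 + q0.2)%N n0)).

(** Orthogonality of characters: the admissible Q are stable under translation by q0 modulo n, which
    multiplies the sum by a number other than 1. *)
Lemma shift_sum_eq0 a b d t1 t2 t3 (q0 : idx) :
  good_shift n a b d q0.1.1 q0.1.2 q0.2 -> shift_phase t1 t2 t3 q0 \isn't a Num.int ->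
  \sum_(q : idx | good_shift n a b d q.1.1 q.1.2 q.2) uexp R (shift_phase t1 t2 t3 q) = 0.
Proof.
move=> g0 nint.
have [_ _ _ h1 /and3P[h2 h3 h4]] := and5P g0.
have addq_inj : injective (addq q0).
  have inj (x y z : 'I_n) : ((x + z) %% n = (y + z) %% n)%N -> x = y.
    move=> /eqP; rewrite eqn_modDr !modn_small// => /eqP; exact: val_inj.
  by move=> [[x y] z] [[x' y'] z'] [/inj-> /inj-> /inj->].
have dv1 x x0 e : (n %| x0 * e)%N -> (n %| ((x + x0) %% n) * e)%N = (n %| x * e)%N.
  by move=> h; rewrite /dvdn modnMml mulnDl -/(dvdn _ _) dvdn_addl.
have dv2 x x0 y y0 e f : (n %| x0 * e + y0 * f)%N ->
    (n %| ((x + x0) %% n) * e + ((y + y0) %% n) * f)%N = (n %| x * e + y * f)%N.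
  move=> h; rewrite /dvdn -modnDm !modnMml modnDm -/(dvdn _ _) !mulnDl addnACA.
  by rewrite dvdn_addl.
have gE q : good_shift n a b d (addq q0 q).1.1 (addq q0 q).1.2 (addq q0 q).2 =
    good_shift n a b d q.1.1 q.1.2 q.2.
  by rewrite /good_shift !ltn_ord /= dv1// dv1// dv2// dv2.
have nz : n%:R != 0 :> rat by rewrite pnatr_eq0 -lt0n.
have pE q : shift_phase t1 t2 t3 q + shift_phase t1 t2 t3 q0 - shift_phase t1 t2 t3 (addq q0 q)
    \is a Num.int.
  have md (x y : nat) : ((x + y) %% n)%N%:R = x%:R + y%:R - ((x + y) %/ n)%N%:R * n%:R :> rat.
    by rewrite -natrD {2}(divn_eq (x + y)%N n) natrD natrM addrAC subrr add0r.
  rewrite /shift_phase /= !md.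
  rewrite (_ : _ - _ = t1%:~R * ((q.1.1 + q0.1.1) %/ n)%N%:R + t2%:~R * ((q.1.2 + q0.1.2) %/ n)%N%:R
    + t3%:~R * ((q.2 + q0.2) %/ n)%N%:R); last by field.
  by rewrite !rpredD// rpredM// ?intr_int// natr_int.
set S := \sum_(q | _) _; apply/eqP.
have : S = uexp R (shift_phase t1 t2 t3 q0) * S.
  rewrite {1}/S (reindex_inj addq_inj) /= mulr_sumr; apply: eq_big => [q|q _]; first exact: gE.
  rewrite -uexpD addrC -[LHS]mul1r -(uexp_int R (pE q)) -uexpD; congr (uexp R _); ring.
move/eqP; rewrite -subr_eq0 -{1}[S]mul1r -mulrBl mulf_eq0 subr_eq0 eq_sym =>
  /orP[/eqP/uexp_eq1 h|//].
by rewrite h in nint.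
Qed.

Lemma shift_sum_card a b d t1 t2 t3 :
  (forall q : idx, good_shift n a b d q.1.1 q.1.2 q.2 ->
     shift_phase t1 t2 t3 q \is a Num.int) ->
  \sum_(q : idx | good_shift n a b d q.1.1 q.1.2 q.2) uexp R (shift_phase t1 t2 t3 q) =
  #|[pred q : idx | good_shift n a b d q.1.1 q.1.2 q.2]|%:R.
Proof.
move=> h; rewrite -sum1_card natr_sum; apply: eq_bigr => q gq.
by rewrite uexp_int ?h.
Qed.

End CharacterSums.

Section ScalarCoefficients.
Variables (R : realType).
Local Notation C := R[i].

Lemma half_integral_psdP (N : 'M[rat]_2) : half_integral_psd R N ->
  exists t1 t2 t3 : int, N = mx22 t1%:~R (t2%:~R / 2) (t2%:~R / 2) t3%:~R.
Proof.
move=> [[Ns _] h1 h2].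
have /intrP[t1 e1] := h1 0; have /intrP[t3 e3] := h1 1; have /intrP[t2 e2] := h2 0 1.
exists t1, t2, t3; apply: mx22P; rewrite !mxE /= -e1 -e3 -e2.
have N10 : N 1 0 = N 0 1.
  have /matrixP/(_ 0 1) := Ns; rewrite !mxE => /(fmorph_inj (ratr : rat -> R)). exact.
by rewrite N10 mulrC mulKf.
Qed.

Lemma half_integral_psd_mx22 (x y z : int) : 0 < x -> y * y <= x * z ->
  half_integral_psd R (mx22 x%:~R y%:~R y%:~R z%:~R).
Proof.
move=> x0 xyz; split.
- split; first by rewrite map_mx22 tr_mx22.
  move=> v; rewrite map_mx22 !mxE !sum2E !mxE !sum2E !mxE /= !ratr_int.
  have x0' : 0 < x%:~R :> R by rewrite ltr0z.
  have xyz' : 0 <= x%:~R * z%:~R - y%:~R * y%:~R :> R.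
    by rewrite subr_ge0 -!intrM ler_int.
  rewrite -(pmulr_rge0 _ x0').
  rewrite (_ : x%:~R * _ = (x%:~R * v 0 0 + y%:~R * v 0 1) ^+ 2 +
     (x%:~R * z%:~R - y%:~R * y%:~R) * (v 0 1) ^+ 2); last by ring.
  by rewrite addr_ge0 ?sqr_ge0// mulr_ge0 ?sqr_ge0.
- by move=> i; rewrite mxE; case: ifP => _; case: ifP => _; exact: intr_int.
- by move=> i j; rewrite mxE rpredM ?natr_int//; case: ifP => _; case: ifP => _; exact: intr_int.
Qed.

Definition scalar_index_mx (n m a b d : nat) : 'M[rat]_2 :=
  (m%:R / n%:R) *: mx22 (a ^ 2 + b ^ 2)%:R (b * d)%:R (b * d)%:R (d ^ 2)%:R.

Lemma index_mx_scalar n (j : hecke_index n) (m : nat) :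
  index_mx j m%:R%:M = scalar_index_mx n m j.1.1.1 j.1.1.2 j.1.2.
Proof.
rewrite /index_mx /scalar_index_mx mul_mx_scalar -scalemxAl scalerA mulrC; congr (_ *: _).
rewrite tr_mx22 mul_mx22; congr mx22; rewrite ?mulr0 ?mul0r ?add0r.
- by rewrite natrD !natrX.
- by rewrite natrM.
- by rewrite natrM mulrC.
- by rewrite natrX.
Qed.

(** The terms are grouped by D, since Q enters only through the phase. L is fixed before m, so
    equations at different scalar matrices can be compared. *)
Lemma hecke_eigen_scalar k n (F : 'M[C]_2 -> C) c : (0 < n)%N -> hecke_eigenform k F ->
  expands F c -> (forall N, N^T != N -> c N = 0) ->
  exists L : C, forall m : nat, L * c m%:R%:M =
    \sum_(t : 'I_n.+1 * 'I_n.+1 * 'I_n.+1 | good_denom n t.1.1 t.1.2 t.2)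
      (t.1.1 * t.2)%:R ^ (- k) * (c (scalar_index_mx n m t.1.1 t.1.2 t.2) *
       \sum_(q : 'I_n * 'I_n * 'I_n | good_shift n t.1.1 t.1.2 t.2 q.1.1 q.1.2 q.2)
         uexp R (\tr (scalar_index_mx n m t.1.1 t.1.2 t.2 *m shift_mx n q.1.1 q.1.2 q.2))).
Proof.
move=> n0 hE hF cs; have [L hL] := hecke_eigen_coeff n0 hE hF cs.
exists L => m; rewrite hL.
under [RHS]eq_bigr => t _ do rewrite mulr_sumr mulr_sumr.
rewrite pair_big_dep /=; apply: eq_bigr => j _.
by rewrite index_mx_scalar.
Qed.

Lemma mxtrace_half_integral n (t1 t2 t3 : int) (q : 'I_n * 'I_n * 'I_n) :
  \tr (mx22 t1%:~R (t2%:~R / 2) (t2%:~R / 2) t3%:~R *m shift_mx n q.1.1 q.1.2 q.2) =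
  shift_phase t1 t2 t3 q.
Proof.
rewrite /shift_mx -scalemxAr mul_mx22 mxtraceZ mxtrace_mx22 /shift_phase mulrC.
by congr (_ * _); field.
Qed.

End ScalarCoefficients.

#[local] Existing Instance totally_filter.

(** * The terms with m prime to n *)

Section ScalarTerms.
Variables (R : realType).
Local Notation C := R[i].
Local Notation toQ := (map_mx (intr : int -> rat)).
Variable c : 'M[rat]_2 -> C.
Hypothesis c_supp : forall N, c N != 0 -> half_integral_psd R N.
Hypothesis c_inv : forall (p q r s : int) (N : 'M[rat]_2), p * s - q * r = 1 ->
  c (toQ (mx22 p q r s) *m N *m (toQ (mx22 p q r s))^T) = c N.

Lemma coeff_unimodular_form (l : rat) (w1 w2 w3 : int) : 0 < w1 -> w1 * w3 - w2 * w2 = 1 ->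
  c (l *: mx22 w1%:~R w2%:~R w2%:~R w3%:~R) = c l%:M.
Proof.
move=> w10 /(unimodular_form_sum2 w10)[p [q [r [s [d -> -> ->]]]]].
rewrite -(c_inv l%:M d); congr (c _).
rewrite mul_mx_scalar -scalemxAl map_mx22 tr_mx22 mul_mx22 !intrD !intrM.
by congr (_ *: mx22 _ _ _ _); ring.
Qed.

Definition shift_sum n m a b d : C :=
  \sum_(q : 'I_n * 'I_n * 'I_n | good_shift n a b d q.1.1 q.1.2 q.2)
     uexp R (\tr (scalar_index_mx n m a b d *m shift_mx n q.1.1 q.1.2 q.2)).

Lemma int_ratM (x y z w : int) : y != 0 -> x%:~R / y%:~R * z%:~R = w%:~R :> rat ->
  x * z = w * y.
Proof.
move=> y0 e; apply: (@intr_inj rat); rewrite !intrM -e.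
by field; rewrite intr_eq0.
Qed.

(** A nonzero sum makes the phase integral at every admissible Q. Testing at Q = diag(0, n/d) gives
    n | m d, hence d = n; then a | b, and testing at Q = diag(n/a, 0) gives n | m a (1 + u^2) with u
    = b/a. Coprimality removes m. *)
Lemma shift_sum_neq0 n m a b d : (0 < n)%N -> coprime m n -> good_denom n a b d ->
  c (scalar_index_mx n m a b d) != 0 -> shift_sum n m a b d != 0 ->
  d = n /\ (n %| a * (1 + (b %/ a) ^ 2))%N.
Proof.
move=> n0 mn gD /c_supp/half_integral_psdP[t1 [t2 [t3 TE]]].
have cop : coprime n m by rewrite coprime_sym.
have [a0 d0] := good_denom_gt0 n0 gD; have /and4P[an dn adn _] := gD.
have nz : n%:Z != 0 by rewrite eqz_nat -lt0n.
have [T1 _ _ T3] := mx22_inj (etrans (esym (scale_mx22 _ _ _ _ _)) TE).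
have {}T1 : m%:Z * (a ^ 2 + b ^ 2)%N%:Z = t1 * n%:Z.
  by apply: int_ratM => //; rewrite -!pmulrn.
have {}T3 : m%:Z * (d ^ 2)%N%:Z = t3 * n%:Z.
  by apply: int_ratM => //; rewrite -!pmulrn.
rewrite /shift_sum TE; under eq_bigr do rewrite mxtrace_half_integral.
move=> S0.
have phase (q : 'I_n * 'I_n * 'I_n) : good_shift n a b d q.1.1 q.1.2 q.2 ->
    shift_phase t1 t2 t3 q \is a Num.int.
  move=> gq; apply: contraNT S0 => nint; apply/eqP.
  exact: shift_sum_eq0 gq nint.
have nq : n%:R != 0 :> rat by rewrite pnatr_eq0 -lt0n.
have dE : d = n.
  suff nd : (n %| d)%N by apply/eqP; rewrite eqn_dvd dn.
  rewrite -(Gauss_dvdr _ cop).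
  (* For d = 1 the test entry n/d = n is not a residue, but integrality of T already gives n | m.
     The case a = 1 below is alike. *)
  have [d1|d1] := leqP d 1.
    have {}d1 : d = 1%N by apply/eqP; rewrite eqn_leq d1.
    rewrite d1 muln1; apply/dvdnP; exists `|t3|%N.
    by move: T3; rewrite d1 => /(congr1 absz); rewrite !abszM /= muln1.
  have zn : (n %/ d < n)%N by rewrite ltn_Pdiv.
  have [|k kE] := intrP (phase (Ordinal n0, Ordinal n0, Ordinal zn) _).
    by rewrite /good_shift /= zn n0 !mul0n ?dvdn0 divnK ?dvdnn.
  have {}kE : t3 * (n %/ d)%N%:Z = k * n%:Z.
    apply: (@intr_inj rat); rewrite !intrM -kE /shift_phase /= -!pmulrn.
    by field.
  have dz : d%:Z != 0 by rewrite eqz_nat -lt0n.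
  have t3k : t3 = k * d%:Z.
    apply: (mulIf nz); rewrite -{1}(divnK dn) PoszM mulrA kE; ring.
  apply/dvdnP; exists `|k|%N.
  suff /(congr1 absz) : m%:Z * d%:Z = k * n%:Z by rewrite !abszM.
  apply: (mulIf dz); rewrite -mulrA -[d%:Z * d%:Z]PoszM mulnn T3 t3k; ring.
split=> //; subst d.
have ab : (a %| b)%N by move: adn; rewrite mulnC dvdn_pmul2l.
have [u bE] : exists u, b = (u * a)%N by exists (b %/ a)%N; rewrite divnK.
have -> : (b %/ a)%N = u by rewrite bE mulnK.
rewrite -(Gauss_dvdr _ cop).
have az : a%:Z != 0 by rewrite eqz_nat -lt0n.
have [a1|a1] := leqP a 1.
  have {}a1 : a = 1%N by apply/eqP; rewrite eqn_leq a1.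
  apply/dvdnP; exists `|t1|%N; rewrite a1 mul1n.
  by move: T1; rewrite bE a1 muln1 exp1n => /(congr1 absz); rewrite !abszM.
have xn : (n %/ a < n)%N by rewrite ltn_Pdiv.
have [|k kE] := intrP (phase (Ordinal xn, Ordinal n0, Ordinal n0) _).
  rewrite /good_shift /= xn n0 !mul0n ?dvdn0 addn0 divnK// dvdnn /= bE mulnCA divnK//.
  by rewrite dvdn_mull.
have {}kE : t1 * (n %/ a)%N%:Z = k * n%:Z.
  apply: (@intr_inj rat); rewrite !intrM -kE /shift_phase /= -!pmulrn.
  by field.
have t1k : t1 = k * a%:Z.
  apply: (mulIf nz); rewrite -{1}(divnK an) PoszM mulrA kE; ring.
apply/dvdnP; exists `|k|%N.
suff /(congr1 absz) : m%:Z * (a * (1 + u ^ 2))%N%:Z = k * n%:Z by rewrite !abszM.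
apply: (mulIf az); rewrite -mulrA -[(a * (1 + u ^ 2))%N%:Z * a%:Z]PoszM.
rewrite (_ : (a * (1 + u ^ 2) * a)%N = (a ^ 2 + b ^ 2)%N); last by rewrite bE; ring.
by rewrite T1 t1k; ring.
Qed.

(** In the surviving case b = u a, n = v a and a (1 + u^2) = w n, so w v - u^2 = 1 and the index is
    m a times the form [[w, u], [u, v]]. All phases are then integral and the sum counts the
    admissible Q. *)
Lemma coeff_term n m a b d : (0 < n)%N -> coprime m n -> good_denom n a b d ->
  c (scalar_index_mx n m a b d) * shift_sum n m a b d =
  if (d == n) && (n %| a * (1 + (b %/ a) ^ 2))%N then
    #|[pred q : 'I_n * 'I_n * 'I_n | good_shift n a b d q.1.1 q.1.2 q.2]|%:R *
    c (m * a)%N%:R%:M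
  else 0.
Proof.
move=> n0 mn gD; case: ifP => [/andP[/eqP dE]|]; last first.
  apply: contraFeq; rewrite mulf_eq0 negb_or => /andP[h1 h2].
  by have [-> ->] := shift_sum_neq0 n0 mn gD h1 h2; rewrite eqxx.
subst d; have [a0 _] := good_denom_gt0 n0 gD; have /and4P[an _ adn _] := gD.
have ab : (a %| b)%N by move: adn; rewrite mulnC dvdn_pmul2l.
have [u bE] : exists u, b = (u * a)%N by exists (b %/ a)%N; rewrite divnK.
have -> : (b %/ a)%N = u by rewrite bE mulnK.
move=> /dvdnP[w wE]; have /dvdnP[v vE] := an.
have nq : n%:R != 0 :> rat by rewrite pnatr_eq0 -lt0n.
have aq : a%:R != 0 :> rat by rewrite pnatr_eq0 -lt0n.
have vz : (w%:Z * v%:Z - u%:Z * u%:Z) = 1.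
  have e : (w * v = 1 + u * u)%N.
    by apply/eqP; rewrite -(eqn_pmul2l a0) mulnn wE vE; apply/eqP; ring.
  by rewrite -!PoszM e PoszD addrK.
have w0 : 0 < w%:Z.
  by rewrite ltz_nat lt0n; apply/negP => /eqP w0; move: wE;
    rewrite w0 mul0n => /eqP; rewrite muln_eq0; lia.
have TE : scalar_index_mx n m a b n =
    (m * a)%N%:R *: mx22 w%:Z%:~R u%:Z%:~R u%:Z%:~R v%:Z%:~R.
  have wQ : a%:R * (1 + u%:R ^+ 2) = w%:R * n%:R :> rat.
    by rewrite -natrX -natrM -wE natrM natrD.
  have vQ : n%:R = v%:R * a%:R :> rat by rewrite -natrM -vE.
  rewrite /scalar_index_mx -!pmulrn !scale_mx22 bE !natrM !natrD !natrX !natrM.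
  have -> : (w%:R : rat) = a%:R * (1 + u%:R ^+ 2) / n%:R by rewrite wQ mulfK.
  have -> : (v%:R : rat) = n%:R / a%:R by rewrite vQ mulfK.
  by congr mx22; field; rewrite ?nq ?aq.
rewrite /shift_sum TE coeff_unimodular_form// mulrC; congr (_ * _).
have -> : (m * a)%N%:R *: mx22 w%:Z%:~R u%:Z%:~R u%:Z%:~R v%:Z%:~R =
  mx22 (m * a * w)%N%:Z%:~R ((2 * (m * a * u))%N%:Z%:~R / 2)
    ((2 * (m * a * u))%N%:Z%:~R / 2) (m * a * v)%N%:Z%:~R :> 'M[rat]_2.
  by rewrite scale_mx22 -!pmulrn !natrM; congr mx22; field.
under eq_bigr do rewrite mxtrace_half_integral.
apply: shift_sum_card => q /and5P[_ _ _ h1 /and3P[_ h3 _]].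
have /dvdnP[x xE] := h1; have /dvdnP[y yE] := h3.
rewrite /shift_phase -!pmulrn -!natrM -!natrD.
have -> : (m * a * w * q.1.1 + 2 * (m * a * u) * q.1.2 + m * a * v * q.2)%N =
  ((m * w * x + 2 * m * u * y + m * q.2) * n)%N.
  rewrite (_ : (m * a * w * q.1.1)%N = (m * w * (q.1.1 * a))%N); last by ring.
  rewrite (_ : (2 * (m * a * u) * q.1.2)%N = (2 * m * u * (q.1.2 * a))%N); last by ring.
  rewrite (_ : (m * a * v * q.2)%N = (m * q.2 * (v * a))%N); last by ring.
  by rewrite xE yE -vE; ring.
by rewrite natrM mulfK// natr_int.
Qed.

End ScalarTerms.

#[local] Existing Instance totally_filter.

(** * Representatives of prime multiplier *)

Section PrimeIndices.
Variable p : nat.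
Hypothesis pp : prime p.
Let p0 : (0 < p)%N := prime_gt0 pp.
Let p1 : (1 < p)%N := prime_gt1 pp.

(** The diagonal of D is one of (1, 1), (p, 1), (p, p), (1, p). In the first two b < 1, in the third
    p | b < p; only the last leaves b free. *)
Lemma sum_good_denom_prime (V : nmodType) (f : nat -> nat -> nat -> V) :
  \sum_(t : 'I_p.+1 * 'I_p.+1 * 'I_p.+1 | good_denom p t.1.1 t.1.2 t.2) f t.1.1 t.1.2 t.2 =
  f 1%N 0%N 1%N + f p 0%N 1%N + f p 0%N p + \sum_(b < p) f 1%N b p.
Proof.
pose g a b d := if good_denom p a b d then f a b d else 0.
have two (G : nat -> V) : (forall a, a != 1%N -> a != p -> G a = 0) ->
    \sum_(a < p.+1) G a = G 1%N + G p.
  move=> G0; rewrite big_ord_recr /=; congr (_ + _).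
  rewrite (bigD1 (Ordinal p1)) //= big1 ?addr0// => a a1; apply: G0 => //.
  by rewrite neq_ltn ltn_ord.
have notdvd a : a != 1%N -> a != p -> (a %| p)%N = false.
  by move=> a1 ap; apply: contraNF a1 => /(prime_nt_dvdP pp) h; apply: contraNT ap => /h ->.
rewrite big_mkcond /=.
rewrite -(pair_bigA _ (fun (ab : 'I_p.+1 * 'I_p.+1) (d : 'I_p.+1) => g ab.1 ab.2 d)) /=.
rewrite -(pair_bigA _ (fun a b : 'I_p.+1 => \sum_(d < p.+1) g a b d)) /=.
under eq_bigr => a _ do rewrite exchange_big /=.
rewrite (two (fun a => \sum_(d < p.+1) \sum_(b < p.+1) g a b d)); last first.
  by move=> a a1 ap; rewrite big1// => d _; rewrite big1// => b _; rewrite /g /good_denom notdvd.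
have dsum a : \sum_(d < p.+1) \sum_(b < p.+1) g a b d =
    \sum_(b < p.+1) g a b 1%N + \sum_(b < p.+1) g a b p.
  apply: (two (fun d => \sum_(b < p.+1) g a b d)) => d d1 dp.
  by rewrite big1// => b _; rewrite /g /good_denom (notdvd d)// andbF.
have b0 a d : (forall b, (0 < b)%N -> good_denom p a b d = false) -> good_denom p a 0 d ->
    \sum_(b < p.+1) g a b d = f a 0%N d.
  move=> h h0; rewrite big_ord_recl big1 ?addr0 => [|i _]; first by rewrite /g h0.
  by rewrite /g h.
have small a b : (0 < b)%N -> good_denom p a b 1 = false.
  by case: b => // b _; rewrite /good_denom ltnS ltn0 !andbF.
have goodp b : (b < p)%N -> good_denom p 1 b p.
  by move=> bp; rewrite /good_denom dvd1n dvdnn mul1n dvdn_mulr.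
have g11 : good_denom p 1 0 1 by rewrite /good_denom dvd1n muln0 dvdn0.
have gp1 : good_denom p p 0 1 by rewrite /good_denom dvdnn dvd1n muln0 dvdn0.
have gpp : good_denom p p 0 p by rewrite /good_denom dvdnn p0 muln0 dvdn0.
have npp b : (0 < b)%N -> good_denom p p b p = false.
  move=> b0'; apply/negP => /and4P[_ _ + bp]; rewrite dvdn_pmul2l// => /(dvdn_leq b0').
  by rewrite leqNgt bp.
rewrite !dsum (b0 _ _ (small 1%N) g11) (b0 _ _ (small p) gp1) (b0 _ _ npp gpp).
rewrite big_ord_recr /= {2}/g /good_denom ltnn !andbF addr0.
rewrite -!addrA; congr (_ + _); rewrite addrC -addrA; congr (_ + (_ + _)).
by apply: eq_bigr => b _; rewrite /g goodp.
Qed.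

Lemma dvdn_ordE (x : 'I_p) : (p %| x)%N = (x == Ordinal p0).
Proof.
apply/idP/eqP => [|->]; last exact: dvdn0.
case: (posnP x) => [x0 _|x0 /(dvdn_leq x0)]; last by rewrite leqNgt ltn_ord.
exact: val_inj.
Qed.

Let card_shift (A B D : pred 'I_p) (P : pred ('I_p * 'I_p * 'I_p)) :
  (forall q, P q = [&& A q.1.1, B q.1.2 & D q.2]) -> #|P| = (#|A| * #|B| * #|D|)%N.
Proof.
move=> PE; rewrite -cardX -cardX; apply: eq_card => q.
have -> : (q \in P) = P q by [].
by rewrite PE !inE andbA.
Qed.

(** Solutions of Q D = 0 modulo p: Q = 0 for D = I, only x free for diag(p, 1), everything free for
    p I, and only z free for [[1, b], [0, p]]. *)
Lemma card_good_shift_prime b :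
  [/\ #|[pred q : 'I_p * 'I_p * 'I_p | good_shift p 1 0 1 q.1.1 q.1.2 q.2]| = 1%N,
      #|[pred q : 'I_p * 'I_p * 'I_p | good_shift p p 0 1 q.1.1 q.1.2 q.2]| = p,
      #|[pred q : 'I_p * 'I_p * 'I_p | good_shift p p 0 p q.1.1 q.1.2 q.2]| = (p ^ 3)%N
    & #|[pred q : 'I_p * 'I_p * 'I_p | good_shift p 1 b p q.1.1 q.1.2 q.2]| = p].
Proof.
pose z := pred1 (Ordinal p0); pose t : pred 'I_p := predT.
have ct : #|t| = p by rewrite card_ord.
have cz : #|z| = 1%N by rewrite card1.
split.
- rewrite (@card_shift z z z) ?cz// => -[[x y] w] /=.
  rewrite /good_shift !ltn_ord /= !muln1 !muln0 !add0n !dvdn_ordE.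
  by case: (x == _); case: (y == _).
- rewrite (@card_shift t z z) ?ct ?cz ?muln1// => -[[x y] w] /=.
  rewrite /good_shift !ltn_ord /= !muln1 !muln0 !add0n !dvdn_ordE !dvdn_mull//.
- rewrite (@card_shift t t t) ?ct ?expnSr ?expn0 ?mul1n// => -[[x y] w] /=.
  by rewrite /good_shift !ltn_ord /= !muln0 !add0n !dvdn_mull.
- rewrite (@card_shift z z t) ?ct ?cz ?mul1n// => -[[x y] w] /=.
  rewrite /good_shift !ltn_ord /= !muln1 !dvdn_ordE !(dvdn_addl _ (dvdn_mull _ (dvdnn _))).
  case: eqP => //= ->; case: eqP => //= [->|_]; rewrite /= ?mul0n ?dvdn0 ?andbF//.
Qed.

(** The index is p^r D D^T, and the phase p^r tr(D^T (Q D / p)) is integral since p divides Q D: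
    here nothing cancels. *)
Lemma shift_sum_prime (R : realType) r a b d : good_denom p a b d ->
  shift_sum R p (p ^ r.+1) a b d =
  #|[pred q : 'I_p * 'I_p * 'I_p | good_shift p a b d q.1.1 q.1.2 q.2]|%:R.
Proof.
move=> _; have pz : p%:R != 0 :> rat by rewrite pnatr_eq0 -lt0n.
have TE : scalar_index_mx p (p ^ r.+1) a b d =
  mx22 (p ^ r * (a ^ 2 + b ^ 2))%N%:Z%:~R ((2 * (p ^ r * (b * d)))%N%:Z%:~R / 2)
    ((2 * (p ^ r * (b * d)))%N%:Z%:~R / 2) (p ^ r * d ^ 2)%N%:Z%:~R.
  rewrite /scalar_index_mx scale_mx22 -!pmulrn expnS !natrM [p%:R * _]mulrC mulfK//.
  by congr mx22; field.
rewrite /shift_sum TE; under eq_bigr do rewrite mxtrace_half_integral.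
apply: shift_sum_card => q /and5P[_ _ _ h1 /and3P[h2 h3 h4]].
rewrite /shift_phase -!pmulrn -!natrM -!natrD.
have -> : (p ^ r * (a ^ 2 + b ^ 2) * q.1.1 + 2 * (p ^ r * (b * d)) * q.1.2 + p ^ r * d ^ 2 * q.2
  = p ^ r * (a * (q.1.1 * a) + b * (q.1.1 * b + q.1.2 * d) + d * (q.1.2 * b + q.2 * d)))%N.
  by ring.
have /dvdnP[k ->] : (p %| p ^ r *
    (a * (q.1.1 * a) + b * (q.1.1 * b + q.1.2 * d) + d * (q.1.2 * b + q.2 * d)))%N.
  by rewrite dvdn_mull// !dvdn_add// dvdn_mull.
by rewrite natrM mulfK// natr_int.
Qed.

End PrimeIndices.

(** * Multiplicativity at coprime arguments *)

Section Multiplicativity.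
Variables (R : realType) (k : int).
Local Notation C := R[i].
Variables (F : 'M[C]_2 -> C) (c : 'M[rat]_2 -> C).
Hypothesis hE : hecke_eigenform k F.
Hypothesis hF : expands F c.
Hypothesis c_supp : forall N, c N != 0 -> half_integral_psd R N.
Local Notation toQ := (map_mx (intr : int -> rat)).

Lemma coeff_sym0 N : N^T != N -> c N = 0.
Proof.
move=> Ns; apply/eqP; apply: contraT => /c_supp[[Ns' _] _ _]; case/eqP: Ns.
apply/matrixP => i j; move/matrixP: Ns' => /(_ i j); rewrite !mxE.
exact: fmorph_inj.
Qed.

Lemma coeff_sl2 (p q r s : int) (N : 'M[rat]_2) : p * s - q * r = 1 ->
  c (toQ (mx22 p q r s) *m N *m (toQ (mx22 p q r s))^T) = c N.
Proof.
move=> d; have [hM _ _] := hE.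
have UW : (mx22 s (- r) (- q) p)^T *m mx22 p q r s = 1%:M.
  by rewrite tr_mx22 mul_mx22 scalar_mx22; congr mx22; rewrite -?d; ring.
by rewrite (coeff_unimodular _ hM hF coeff_sym0 UW) det_mx22 d exp1rz mul1r.
Qed.

(* l depends on n only: all the contributions to the coefficient at m I of the
   n-th Hecke operator are c(a m I) with a | n, and a = n occurs once. *)
Lemma coeff_scalar_mult n : (0 < n)%N -> exists l : C, forall m, coprime m n ->
  c (m * n)%N%:R%:M = l * c m%:R%:M.
Proof.
have [b] := ubnP n; elim: b n => // b IH n nb n0.
(* The guard [0 < a < n] sits inside the existential so that [choice] gives one function l on all of
   nat. *)
have IHl (a : nat) : exists l : C, (0 < a < n)%N -> forall m, coprime m a ->
    c (m * a)%N%:R%:M = l * c m%:R%:M.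
  case: (boolP (0 < a < n)%N) => [/andP[a0 an]|]; last by exists 0.
  have [|l hl] := IH a _ a0; last by exists l.
  by apply: leq_trans an _; rewrite -ltnS.
have [l hl] := choice IHl.
have [L hL] := hecke_eigen_scalar n0 hE hF coeff_sym0.
pose w (t : 'I_n.+1 * 'I_n.+1 * 'I_n.+1) : C := (t.1.1 * t.2)%:R ^ (- k).
pose nG (t : 'I_n.+1 * 'I_n.+1 * 'I_n.+1) : C :=
  #|[pred q : 'I_n * 'I_n * 'I_n | good_shift n t.1.1 t.1.2 t.2 q.1.1 q.1.2 q.2]|%:R.
pose cnd (t : 'I_n.+1 * 'I_n.+1 * 'I_n.+1) :=
  (t.2 == n :> nat) && (n %| t.1.1 * (1 + (t.1.2 %/ t.1.1) ^ 2))%N.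
(* t0 is D = n I. It yields the coefficient at m n I, with nonzero weight because Q = 0 is
   admissible. *)
pose t0 : 'I_n.+1 * 'I_n.+1 * 'I_n.+1 := (ord_max, ord0, ord_max).
have g0 : good_denom n t0.1.1 t0.1.2 t0.2.
  by rewrite /good_denom /= dvdnn n0 muln0 dvdn0.
have w0 : w t0 * nG t0 != 0.
  rewrite mulf_neq0//; first by rewrite expfz_neq0// pnatr_eq0 -lt0n muln_gt0 /= n0.
  rewrite pnatr_eq0 -lt0n; apply/card_gt0P.
  exists (Ordinal n0, Ordinal n0, Ordinal n0).
  by rewrite inE /good_shift /= n0 !mul0n dvdn0.
pose S := \sum_(t : 'I_n.+1 * 'I_n.+1 * 'I_n.+1 |
  good_denom n t.1.1 t.1.2 t.2 && (t != t0)) if cnd t then w t * nG t * l t.1.1 else 0.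
exists ((w t0 * nG t0)^-1 * (L - S)) => m mn.
apply: (mulfI w0); rewrite mulrA mulVKf// mulrBl (hL m) (bigD1 t0)//=.
have -> : S * c m%:R%:M = \sum_(t : 'I_n.+1 * 'I_n.+1 * 'I_n.+1 |
  good_denom n t.1.1 t.1.2 t.2 && (t != t0)) w t *
    (c (scalar_index_mx n m t.1.1 t.1.2 t.2) * shift_sum R n m t.1.1 t.1.2 t.2).
  rewrite mulr_suml; apply: eq_bigr => t /andP[gt tt0].
  rewrite (coeff_term c_supp coeff_sl2 n0 mn gt) -/(cnd t) -/(nG t).
  case: ifP => [/andP[/eqP dn ct]|_]; last by rewrite mul0r mulr0.
  have [a0 _] := good_denom_gt0 n0 gt; have [an _ adn bd] := and4P gt.
  (* With d = n, the value a = n would force n | b < n, hence t = t0; all other terms fall under the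
     induction hypothesis. *)
  have an' : (t.1.1 < n)%N.
    rewrite ltn_neqAle (dvdn_leq n0 an) andbT; apply: contra tt0 => /eqP aE.
    have b0 : t.1.2 = 0%N :> nat.
      apply/eqP; rewrite -leqn0 leqNgt; apply/negP => b0.
      move: adn; rewrite dn aE dvdn_pmul2l// => /(dvdn_leq b0).
      by rewrite leqNgt; move: bd; rewrite dn => ->.
    case: t aE dn b0 {gt ct a0 an adn bd} => [[x y] z] /= aE dn b0.
    by apply/eqP; congr (_, _, _); apply: val_inj.
  rewrite hl ?a0 ?an'//; first by rewrite !mulrA.
  exact: coprime_dvdr an mn.
rewrite -/(shift_sum R n m n 0 n) addrK.
have := coeff_term c_supp coeff_sl2 n0 mn g0.
rewrite /= eqxx div0n dvdn_mulr//= => ->.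
by rewrite mulrA.
Qed.

End Multiplicativity.

#[local] Existing Instance totally_filter.

(** * The recursion along powers of a prime *)

Section PrimeRecursion.
Variables (R : realType) (k : int).
Local Notation C := R[i].
Variables (F : 'M[C]_2 -> C) (c : 'M[rat]_2 -> C).
Hypothesis hE : hecke_eigenform k F.
Hypothesis hF : expands F c.
Hypothesis c_supp : forall N, c N != 0 -> half_integral_psd R N.
Local Notation toQ := (map_mx (intr : int -> rat)).
Variable p : nat.
Hypothesis pp : prime p.
Let p0 : (0 < p)%N := prime_gt0 pp.
Let pz : p%:R != 0 :> rat.
Proof. by rewrite pnatr_eq0 -lt0n. Qed.

(** (p^r / p) D D^T for D = [[1, u], [0, p]], the index produced by this D at p^r I. *)
Definition neighbour r u : 'M[rat]_2 :=
  p%:R ^+ r *: mx22 ((1 + u%:R ^+ 2) * p%:R^-1) u%:R u%:R p%:R.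

(** The swap is realized in SL_2(Z), so no sign appears. It identifies the terms of D = diag(p, 1)
    and D = diag(1, p), whence the factor 2 in the recursion. *)
Lemma coeff_diag_swap (x y : rat) : c (mx22 x 0 0 y) = c (mx22 y 0 0 x).
Proof.
have d : (0 : int) * 0 - 1 * (-1) = 1 by [].
rewrite -(coeff_sl2 hE hF c_supp (mx22 x 0 0 y) d); congr (c _).
by rewrite map_mx22 tr_mx22 !mul_mx22; congr mx22; ring.
Qed.

Lemma neighbour0 r : neighbour r.+1 0 = mx22 (p%:R ^+ r) 0 0 (p%:R ^+ r.+2).
Proof.
rewrite /neighbour scale_mx22 !mulr0 expr0n addr0 mul1r.
by congr mx22; rewrite ?exprSr ?mulfK.
Qed.

Lemma coeff_neighbour_dvd r u : (p %| 1 + u ^ 2)%N ->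
  c (neighbour r u) = c (p ^ r)%N%:R%:M.
Proof.
move=> /dvdnP[w wE]; have w0 : 0 < w%:Z.
  by rewrite ltz_nat lt0n; apply: contra_eqN wE => /eqP ->; rewrite mul0n.
have e : w%:Z * p%:Z - u%:Z * u%:Z = 1.
  by rewrite -!PoszM -wE -mulnn PoszD addrK.
rewrite natrX -(coeff_unimodular_form (coeff_sl2 hE hF c_supp) (p%:R ^+ r) w0 e) -!pmulrn.
congr (c (_ *: mx22 _ _ _ _)).
by rewrite -natrX -(natrD _ 1) wE natrM mulfK.
Qed.

(** [[1, -1], [0, -1]] has determinant -1 and carries the form at u to the one at p - u. *)
Lemma coeff_neighbour_opp r u : (u <= p)%N ->
  c (neighbour r (p - u)) = (-1) ^ k * c (neighbour r u).
Proof.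
move=> up; have [hM _ _] := hE.
have UW : (mx22 1 0 (-1) (-1))^T *m mx22 1 (-1) 0 (-1) = 1%:M :> 'M[int]_2.
  by rewrite tr_mx22 mul_mx22 scalar_mx22; congr mx22.
have := coeff_unimodular (neighbour r u) hM hF (coeff_sym0 c_supp) UW.
rewrite det_mx22 (_ : 1 * -1 - -1 * 0 = -1 :> int)// rmorphN1 => <-; congr (c _).
rewrite map_mx22 tr_mx22 /neighbour -scalemxAr -scalemxAl !mul_mx22 natrB//.
by congr (_ *: mx22 _ _ _ _); field.
Qed.

(** u = 0 gives the diagonal matrix and the roots of u^2 = -1 give scalar matrices; the remaining u
    are paired with p - u, which produces the factor 1 + (-1)^k and the half range. *)
Lemma coeff_neighbour_sum r :
  \sum_(u < p) c (neighbour r.+1 u) =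
  c (mx22 (p%:R ^+ r) 0 0 (p%:R ^+ r.+2)) +
  #|[pred u : 'I_p | (p %| 1 + u ^ 2)%N]|%:R * c (p ^ r.+1)%N%:R%:M +
  (1 + (-1) ^ k) * \sum_(1 <= u < (p.-1)./2.+1 | ~~ (p %| 1 + u ^ 2)%N) c (neighbour r.+1 u).
Proof.
have p1 := prime_gt1 pp.
rewrite (bigID (fun u : 'I_p => (p %| 1 + u ^ 2)%N)) /=.
rewrite (eq_bigr (fun=> c (p ^ r.+1)%N%:R%:M)); last by move=> u; exact: coeff_neighbour_dvd.
rewrite sumr_const [X in _ = X + _]addrC -addrA; congr (_ + _); first by rewrite mulr_natl.
have -> : \sum_(u < p | ~~ (p %| 1 + u ^ 2)%N) c (neighbour r.+1 u) =
  \sum_(0 <= u < p | ~~ (p %| 1 + u ^ 2)%N) c (neighbour r.+1 u) by rewrite big_mkord.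
rewrite [in LHS]big_ltn_cond//= dvdn1 gtn_eqF//= neighbour0; congr (_ + _).
set P := fun u => ~~ (p %| 1 + u ^ 2)%N; set h := (p.-1)./2.
have Pp u : (u <= p)%N -> P (p - u)%N = P u.
  move=> up; rewrite /P; congr (~~ _).
  have e : ((p - u) ^ 2 + 2 * p * u = p * p + u ^ 2)%N by rewrite -{2 3 4}(subnK up); ring.
  rewrite -(dvdn_addl _ (_ : (p %| 2 * p * u)%N)); last by rewrite -mulnA mulnCA dvdn_mulr.
  by rewrite -addnA e addnCA dvdn_addr// dvdn_mulr.
(* For p = 2 only u = 1 is left, and 2 | 1 + 1 excludes it: both sums are empty. *)
have [p2|podd] := even_prime pp.
  rewrite /h p2 /= [in RHS]big_geq// mulr0 big_mkcond big_nat1 ?/P ?p2.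
  by [].
have pE : p = (h + h).+1.
  by rewrite addnn /h; move: (odd_double_half p.-1); rewrite -subn1 oddB// podd /=
    add0n => ->; rewrite subn1 prednK.
have hp : (h.+1 <= p)%N by rewrite pE ltnS leq_addr.
rewrite (@big_cat_nat _ _ _ h.+1)//=.
rewrite mulrDl mul1r; congr (_ + _).
rewrite mulr_sumr (big_mkcond P) [in RHS](big_mkcond P) /=.
rewrite -[in X in X = _](add1n h) big_addn {1}pE (_ : (h + h).+1 - h = h.+1)%N; last first.
  by rewrite -addnS addKn.
rewrite big_nat_rev /=; apply: eq_big_nat => u /andP[u1 uh].
have -> : (1 + h.+1 - u.+1 + h = p - u)%N.
  by move: pE uh; clearbody h; clear; lia.
have up : (u <= p)%N := leq_trans (ltnW uh) hp.
by rewrite Pp// coeff_neighbour_opp.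
Qed.

Lemma prime_hecke_terms : exists L : C, forall m,
  L * c m%:R%:M = c (scalar_index_mx p m 1 0 1) * shift_sum R p m 1 0 1 +
    (p * 1)%:R ^ (- k) * (c (scalar_index_mx p m p 0 1) * shift_sum R p m p 0 1) +
    (p * p)%:R ^ (- k) * (c (scalar_index_mx p m p 0 p) * shift_sum R p m p 0 p) +
    \sum_(b < p) (1 * p)%:R ^ (- k) * (c (scalar_index_mx p m 1 b p) * shift_sum R p m 1 b p).
Proof.
have [L hL] := hecke_eigen_scalar p0 hE hF (coeff_sym0 c_supp).
exists L => m; rewrite hL.
rewrite (sum_good_denom_prime pp (fun a b d => (a * d)%:R ^ (- k) *
  (c (scalar_index_mx p m a b d) * shift_sum R p m a b d))).
by rewrite exp1rz mul1r.
Qed.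

Let g11 : good_denom p 1 0 1.
Proof. by rewrite /good_denom dvd1n muln0 dvdn0. Qed.
Let gp1 : good_denom p p 0 1.
Proof. by rewrite /good_denom dvdnn dvd1n muln0 dvdn0. Qed.
Let gpp : good_denom p p 0 p.
Proof. by rewrite /good_denom dvdnn p0 muln0 dvdn0. Qed.
Let g1p b : (b < p)%N -> good_denom p 1 b p.
Proof. by move=> bp; rewrite /good_denom dvd1n dvdnn mul1n dvdn_mulr. Qed.

Lemma scalar_index_prime r b :
  [/\ scalar_index_mx p (p ^ r.+1) 1 0 1 = (p ^ r)%N%:R%:M,
      scalar_index_mx p (p ^ r.+1) p 0 1 = mx22 (p%:R ^+ r.+2) 0 0 (p%:R ^+ r),
      scalar_index_mx p (p ^ r.+1) p 0 p = (p ^ r.+2)%N%:R%:M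
    & scalar_index_mx p (p ^ r.+1) 1 b p = neighbour r.+1 b].
Proof.
rewrite /scalar_index_mx /neighbour !scalar_mx22 !scale_mx22 !expnS !natrM !exprS !natrX.
rewrite !natrD !natrM !natrX.
by split; congr mx22; field.
Qed.

(** The equation at p^(r+1) I is multiplied by c(I), and L c(I) is replaced by its value from the
    equation at I. The number rho of roots of u^2 = -1 occurs in both with the same weight and
    disappears. *)
Lemma prime_recursion r : c 1%:M * c (p ^ r.+2)%N%:R%:M =
  c p%:R%:M * c (p ^ r.+1)%N%:R%:M - p%:R ^ (2 * k - 3) * c 1%:M * c (p ^ r)%N%:R%:M
  - p%:R ^ (k - 2) * c 1%:M * (2 * c (mx22 (p%:R ^+ r) 0 0 (p%:R ^+ r.+2)) +
     (1 + (-1) ^ k) * \sum_(1 <= u < (p.-1)./2.+1 | ~~ (p %| 1 + u ^ 2)%N) c (neighbour r.+1 u)).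
Proof.
have [L hL] := prime_hecke_terms.
have p1 := prime_gt1 pp.
have Pz : p%:R != 0 :> C by rewrite pnatr_eq0 -lt0n.
pose x : C := p%:R ^ (- k); pose P : C := p%:R.
have [k1 k2 k3 _] := card_good_shift_prime pp 0.
pose rho : C := #|[pred u : 'I_p | (p %| 1 + u ^ 2)%N]|%:R.
have xx : (p * p)%:R ^ (- k) = x * x :> C by rewrite natrM expfzMl.
(* At m = 1 only D = p I and the D = [[1, b], [0, p]] with p | 1 + b^2 survive. *)
have e1 : L * c 1%:M = x * x * P ^+ 3 * c p%:R%:M + x * P * rho * c 1%:M.
  rewrite (hL 1%N) !(coeff_term c_supp (coeff_sl2 hE hF c_supp) p0 (coprime1n p)) ?g11 ?gp1 ?gpp//.
  rewrite !(ltn_eqF p1) /= !mulr0 !add0r eqxx div0n dvdn_mulr//= k3 mul1n.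
  rewrite xx natrX mulrA; congr (_ + _).
  rewrite (eq_bigr (fun b : 'I_p => if (p %| 1 + b ^ 2)%N then x * P * c 1%:M else 0)).
    rewrite -big_mkcond /= sumr_const -mulr_natl /rho; ring.
  move=> b _; have [_ _ _ k4] := card_good_shift_prime pp b.
  rewrite (coeff_term c_supp (coeff_sl2 hE hF c_supp) p0 (coprime1n p)) ?g1p//.
  rewrite eqxx divn1 !mul1n k4 /=; case: ifP => _; last by rewrite mulr0.
  by rewrite mulrA.
have := hL (p ^ r.+1)%N.
have [-> -> -> _] := scalar_index_prime r 0.
rewrite !shift_sum_prime// k1 k2 k3.
rewrite (eq_bigr (fun b : 'I_p => x * P * c (neighbour r.+1 b))); last first.
  move=> b _; have [_ _ _ k4] := card_good_shift_prime pp b.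
  have [_ _ _ ->] := scalar_index_prime r b.
  by rewrite shift_sum_prime ?g1p// k4 mul1n mulrAC -!mulrA.
rewrite -mulr_sumr coeff_neighbour_sum -/rho xx muln1 [(p ^ 3)%N%:R]natrX coeff_diag_swap -/x -/P.
set S := \sum_(1 <= u < _ | _) _; set E := c (mx22 _ _ _ _); set eps := (-1) ^ k.
move: e1; set A0 := c 1%:M; set A1 := c p%:R%:M; set Ar := c (p ^ r.+1)%N%:R%:M.
set A2 := c (p ^ r.+2)%N%:R%:M; set Am := c (p ^ r)%N%:R%:M => e1 e2.
have x0 : x != 0 by rewrite expfz_neq0.
have main : x * x * P ^+ 3 * (A0 * A2) = x * x * P ^+ 3 * (A1 * Ar) - A0 * Am
    - x * P * A0 * (2 * E + (1 + eps) * S).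
  have -> : x * x * P ^+ 3 * (A0 * A2) =
      A0 * (L * Ar - Am - x * P * (2 * E + rho * Ar + (1 + eps) * S)).
    by rewrite e2; ring.
  have -> : A0 * (L * Ar - Am - x * P * (2 * E + rho * Ar + (1 + eps) * S)) =
     (L * A0) * Ar - A0 * Am - x * P * A0 * (2 * E + rho * Ar + (1 + eps) * S) by ring.
  by rewrite e1; ring.
(* With x = p^-k, division by the weight x^2 p^3 of D = p I turns the factors 1 and x p into
   p^(2k-3) and p^(k-2). *)
have xV : x^-1 = P ^ k by rewrite /x -invr_expz invrK.
have y1 : P ^ (2 * k - 3) = x^-1 * x^-1 / P ^+ 3.
  have -> : 2 * k - 3 = (k + k) + (- 3%:Z) by ring.
  by rewrite (expfzDr (k + k) _ Pz) (expfzDr k k Pz) xV.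
have y2 : P ^ (k - 2) = x^-1 / P ^+ 2.
  by rewrite (expfzDr k (- 2%:Z) Pz) xV.
rewrite y1 y2.
have nz : x * x * P ^+ 3 != 0 by rewrite !mulf_neq0 ?expf_neq0.
apply: (mulfI nz); rewrite main; field.
by rewrite x0 Pz.
Qed.

End PrimeRecursion.

(** * Return from the truncated coefficients to the given ones *)

Theorem theorem1p1 (R : realType) (k : int) (F : 'M[R[i]]_2 -> R[i])
    (a : 'M[rat]_2 -> R[i])
    (hF : hecke_eigenform k F) (ha : fourier_expansion F a) :
  [/\ (a 1%:M = 0 -> forall m : nat, (0 < m)%N -> a (m%:R%:M) = 0),
      (forall m n : nat, (0 < m)%N -> (0 < n)%N -> coprime m n ->
         a 1%:M * a ((m * n)%N%:R%:M) = a (m%:R%:M) * a (n%:R%:M))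
    & (forall p r : nat, prime p -> (1 <= r)%N ->
         a 1%:M * a ((p ^ r.+1)%N%:R%:M) =
           a (p%:R%:M) * a ((p ^ r)%N%:R%:M)
           - p%:R ^ (2 * k - 3) * a 1%:M * a ((p ^ r.-1)%N%:R%:M)
           - p%:R ^ (k - 2) * a 1%:M *
             (2 * a (mx22 (p%:R ^+ r.-1) 0 0 (p%:R ^+ r.+1))
              + (1 + (-1) ^ k) *
                \sum_(1 <= u < (p.-1)./2.+1
                       | (u%:Z ^+ 2 != -1 %[mod p%:Z])%Z)
                  a (p%:R ^+ r *: mx22 ((1 + u%:R ^+ 2) * p%:R^-1) u%:R
                                       u%:R p%:R)))].
Proof.
(* The expansion says nothing about [a] off the half-integral semidefinite matrices, so [a] is cut
   off there; every matrix in the statement lies in the support, where [a] and c agree. *)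
pose c N := if N \in half_integral_psd R then a N else 0.
have hE : expands F c := fourier_expansion_expands ha.
have c_supp N : c N != 0 -> half_integral_psd R N.
  by rewrite /c; case: ifP => [/set_mem//|_]; rewrite eqxx.
have ac N : half_integral_psd R N -> a N = c N by move=> /mem_set h; rewrite /c h.
have aI m : (0 < m)%N -> a m%:R%:M = c m%:R%:M.
  move=> m0; apply: ac; rewrite scalar_mx22 -[m%:R]/(m%:Z%:~R) -[0]/(0%:Z%:~R).
  by apply: half_integral_psd_mx22; rewrite ?ltz_nat// mulr0 mulr_ge0.
have a1 : a 1%:M = c 1%:M by exact: (aI 1%N).
(* The same l serves all n prime to m; taking n = 1 identifies l a(I) with a(m I), which gives the
   first two claims. *)
have mult m : (0 < m)%N -> exists l : R[i], forall n, (0 < n)%N -> coprime n m ->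
    a (n * m)%N%:R%:M = l * a n%:R%:M.
  move=> m0; have [l hl] := coeff_scalar_mult hF hE c_supp m0.
  by exists l => n n0 nm; rewrite !aI ?muln_gt0 ?n0// hl.
split=> [a10 m m0|m n m0 n0 mn|p r pp].
- have [l hl] := mult m m0.
  by have := hl 1%N isT (coprime1n m); rewrite mul1n a10 mulr0.
- have [l hl] := mult n n0.
  have := hl 1%N isT (coprime1n n); rewrite mul1n => ->.
  by rewrite hl// [RHS]mulrC mulrCA mulrA.
(* Writing r + 1 for r turns the predecessor in the statement into r, as in [prime_recursion]. *)
- case: r => // r _; have p0 := prime_gt0 pp.
  have aN u : a (p%:R ^+ r.+1 *: mx22 ((1 + u%:R ^+ 2) * p%:R^-1) u%:R u%:R p%:R) =
      c (neighbour p r.+1 u).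
    rewrite -/(neighbour p r.+1 u); apply: ac.
    have -> : neighbour p r.+1 u = mx22 (p ^ r * (1 + u ^ 2))%N%:Z%:~R (p ^ r.+1 * u)%N%:Z%:~R
        (p ^ r.+1 * u)%N%:Z%:~R (p ^ r.+2)%N%:Z%:~R.
      have pz : p%:R != 0 :> rat by rewrite pnatr_eq0 -lt0n.
      rewrite /neighbour scale_mx22 -!pmulrn !natrM natrD !natrX !exprS.
      by congr mx22; field.
    apply: half_integral_psd_mx22; first by rewrite ltz_nat muln_gt0 expn_gt0 p0.
    rewrite -!PoszM lez_nat (_ : p ^ r.+1 * u * (p ^ r.+1 * u) = p ^ r * p ^ r.+2 * u ^ 2)%N.
      by rewrite [leqRHS]mulnAC leq_mul// leq_addl.
    by rewrite !expnS; ring.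
  have aE : a (mx22 (p%:R ^+ r) 0 0 (p%:R ^+ r.+2)) = c (mx22 (p%:R ^+ r) 0 0 (p%:R ^+ r.+2)).
    apply: ac; rewrite -!natrX -[_%:R]/((p ^ r)%N%:Z%:~R) -[(p ^ r.+2)%:R]/((p ^ r.+2)%N%:Z%:~R).
    rewrite -[0]/(0%:Z%:~R); apply: half_integral_psd_mx22.
      by rewrite ltz_nat expn_gt0 p0.
    by rewrite mulr0 mulr_ge0.
  rewrite !aI ?expn_gt0 ?p0// a1 /= aE (prime_recursion hF hE c_supp pp).
  congr (_ - _ * (_ + _ * _)); apply: eq_big => u; last by move=> _; rewrite aN.
  congr (~~ _); rewrite eqz_mod_dvd opprK.
  by rewrite (_ : u%:Z ^+ 2 + 1 = (1 + u ^ 2)%N%:Z)// PoszD addrC -!rmorphXn.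
Qed.
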